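(* Let $\Omega \subseteq \mathbb{C}$ be an open set and $F \subseteq \mathbb{N}_0$ be a non-empty set. Then the space $\mathcal{A}_{F}(\Omega)$ with its natural topology is a complete metric space.
   Context: $\mathbb{N}_0=\{0,1,2,\dots\}$. For an open set $\Omega\subseteq\mathbb{C}$, $H(\Omega)$ is the set of holomorphic functions on $\Omega$, and $\mathcal{A}(\Omega)$ is the set of those $f\in H(\Omega)$ possessing a continuous extension on $\overline{\Omega}$, the closure being taken in $\mathbb{C}$; the extension is denoted by the same symbol. For non-empty $F\subseteq\mathbb{N}_0$, $\mathcal{A}_F(\Omega)=\{f\in H(\Omega): f^{(l)}\in\mathcal{A}(\Omega) \text{ for all } l\in F\}$. Let $\Omega_i$, $i\in I$ ($I$ finite or $I=\mathbb{N}$), be the connected components of $\Omega$ and fix a point $z_i\in\Omega_i$ for each $i\in I$. The natural topology of $\mathcal{A}_F(\Omega)$ is the one induced by the countable family of seminorms $\sup_{z\in\overline{\Omega},\,|z|\leqslant n}|f^{(l)}(z)|$, $l\in F$, $n\in\mathbb{N}$, and $|f^{(l)}(z_i)|$, $0\leqslant l<\min F$, $i\in I$. The metric meant is the usual translation-invariant metric associated with this countable family of seminorms, so the assertion is that $\mathcal{A}_F(\Omega)$ is a Fréchet space. *)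

(* Defs.v *)
From Stdlib Require Import Reals List ClassicalEpsilon.
From Coquelicot Require Import Coquelicot.
Open Scope R_scope.

(** * Topology of the complex plane *)

Definition closure (S : C -> Prop) (z : C) : Prop :=
  forall P : C -> Prop, locally z P -> exists w, P w /\ S w.

Definition connected (S : C -> Prop) : Prop :=
  forall U V : C -> Prop, open U -> open V ->
    (forall w, S w -> U w \/ V w) ->
    (exists w, S w /\ U w) -> (exists w, S w /\ V w) ->
    exists w, S w /\ U w /\ V w.

Definition connected_component (Omega S : C -> Prop) : Prop :=
  (exists w, S w) /\ (forall w, S w -> Omega w) /\ connected S /\
  forall T : C -> Prop, connected T -> (forall w, T w -> Omega w) ->
    (forall w, S w -> T w) -> forall w, T w -> S w.

Definition finite_or_full (I : nat -> Prop) : Prop :=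
  (exists N, forall i, I i -> (i <= N)%nat) \/ (forall i, I i).

(** [comp i], for [i] in [I], lists every connected component of [Omega]
    exactly once. *)
Definition components_of (Omega : C -> Prop) (I : nat -> Prop)
    (comp : nat -> C -> Prop) : Prop :=
  (forall i, I i -> connected_component Omega (comp i)) /\
  (forall S, connected_component Omega S ->
     exists i, I i /\ forall w, S w <-> comp i w) /\
  (forall i j, I i -> I j -> (forall w, comp i w <-> comp j w) -> i = j).

(** * The function spaces *)

Definition holomorphic (Omega : C -> Prop) (f : C -> C) : Prop :=
  forall z, Omega z -> ex_derive f z.

(** [C_derive f z] is the complex derivative wherever [f] is complex
    differentiable; elsewhere its value is junk.  Below, only its values on an
    open set on which [f] is holomorphic are used. *)
Definition C_derive_n (l : nat) (f : C -> C) : C -> C := Nat.iter l C_derive f.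

Definition continuous_extension (Omega : C -> Prop) (f g : C -> C) : Prop :=
  (forall z, Omega z -> g z = f z) /\ continuous_on (closure Omega) g.

Definition A_space (Omega : C -> Prop) (f : C -> C) : Prop :=
  holomorphic Omega f /\ exists g, continuous_extension Omega f g.

(** The values of [extension Omega f] are meaningful on [closure Omega] only,
    where two continuous extensions of [f] agree. *)
Definition extension (Omega : C -> Prop) (f : C -> C) : C -> C :=
  epsilon (inhabits f) (continuous_extension Omega f).

(** A function on [Omega] is represented by the function on [C] that agrees
    with it on [Omega] and vanishes elsewhere, so that equality of elements of
    the space is equality of Rocq functions.  The values off the open set
    [Omega] play no role in the derivatives at points of [Omega]. *)
Definition A_F (Omega : C -> Prop) (F : nat -> Prop) (f : C -> C) : Prop :=
  (forall z, ~ Omega z -> f z = RtoC 0) /\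
  holomorphic Omega f /\
  forall l, F l -> A_space Omega (C_derive_n l f).

(** * The natural seminorms *)

Inductive seminorm_index : Type :=
  | SupIndex (l n : nat)
  | PointIndex (l i : nat).

(** For non-empty [F], the condition on [l] in the second case says that [l]
    is smaller than the minimum of [F]. *)
Definition natural_index (F I : nat -> Prop) (j : seminorm_index) : Prop :=
  match j with
  | SupIndex l n => F l /\ (1 <= n)%nat
  | PointIndex l i => (forall m, F m -> (l < m)%nat) /\ I i
  end.

(** The value 0 is added to the set of moduli so that the supremum is 0, and
    not [m_infty], when no point of [closure Omega] lies in the disc. *)
Definition natural_seminorm (Omega : C -> Prop) (z : nat -> C)
    (j : seminorm_index) (f : C -> C) : Rbar :=
  match j with
  | SupIndex l n =>
      Lub_Rbar (fun r => r = 0 \/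
        exists w, closure Omega w /\ Cmod w <= INR n /\
          r = Cmod (extension Omega (C_derive_n l f) w))
  | PointIndex l i => Finite (Cmod (C_derive_n l f (z i)))
  end.

(** Repetitions are allowed. *)
Definition enumerates {J : Type} (e : nat -> J) (P : J -> Prop) : Prop :=
  (forall k, P (e k)) /\ (forall j, P j -> exists k, e k = j).

(** * Metrics and seminorms on sets of complex functions *)

Definition fplus (f g : C -> C) : C -> C := fun w => Cplus (f w) (g w).
Definition fminus (f g : C -> C) : C -> C := fun w => Cminus (f w) (g w).
Definition fscal (c : C) (f : C -> C) : C -> C := fun w => Cmult c (f w).

Definition seminorm_dist {J : Type} (p : J -> (C -> C) -> Rbar) (e : nat -> J)
    (f g : C -> C) : R :=
  Series (fun k => (/ 2) ^ (S k) *
    (real (p (e k) (fminus f g)) / (1 + real (p (e k) (fminus f g))))).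

Definition linear_subspace (A : (C -> C) -> Prop) : Prop :=
  A (fun _ => RtoC 0) /\
  (forall f g, A f -> A g -> A (fplus f g)) /\
  (forall c f, A f -> A (fscal c f)).

Definition is_seminorm (A : (C -> C) -> Prop) (p : (C -> C) -> Rbar) : Prop :=
  (forall f, A f -> is_finite (p f) /\ 0 <= real (p f)) /\
  (forall f g, A f -> A g -> real (p (fplus f g)) <= real (p f) + real (p g)) /\
  (forall c f, A f -> real (p (fscal c f)) = Cmod c * real (p f)).

Definition is_metric {X : Type} (A : X -> Prop) (d : X -> X -> R) : Prop :=
  (forall x y, A x -> A y -> 0 <= d x y) /\
  (forall x y, A x -> A y -> (d x y = 0 <-> x = y)) /\
  (forall x y, A x -> A y -> d x y = d y x) /\
  (forall x y z, A x -> A y -> A z -> d x z <= d x y + d y z).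

Definition translation_invariant (A : (C -> C) -> Prop)
    (d : (C -> C) -> (C -> C) -> R) : Prop :=
  forall f g h, A f -> A g -> A h -> d (fplus f h) (fplus g h) = d f g.

Definition is_complete {X : Type} (A : X -> Prop) (d : X -> X -> R) : Prop :=
  forall u : nat -> X, (forall n, A (u n)) ->
    (forall eps, 0 < eps -> exists N, forall m n,
       (N <= m)%nat -> (N <= n)%nat -> d (u m) (u n) < eps) ->
    exists x, A x /\ is_lim_seq (fun n => d (u n) x) 0.

Definition metric_open {X : Type} (A : X -> Prop) (d : X -> X -> R)
    (U : X -> Prop) : Prop :=
  forall x, A x -> U x ->
    exists eps, 0 < eps /\ forall y, A y -> d x y < eps -> U y.

Definition seminorm_open {J : Type} (A : (C -> C) -> Prop) (P : J -> Prop)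
    (p : J -> (C -> C) -> Rbar) (U : (C -> C) -> Prop) : Prop :=
  forall f, A f -> U f ->
    exists (s : list J) (eps : R), List.Forall P s /\ 0 < eps /\
      forall g, A g -> List.Forall (fun j => real (p j (fminus g f)) < eps) s -> U g.

(** [A], with the topology defined by the seminorms [p j], [j] in [P], is a
    Frechet space, and [d] is a complete translation-invariant metric for that
    topology. *)
Definition frechet_space {J : Type} (A : (C -> C) -> Prop) (P : J -> Prop)
    (p : J -> (C -> C) -> Rbar) (d : (C -> C) -> (C -> C) -> R) : Prop :=
  linear_subspace A /\
  (forall j, P j -> is_seminorm A (p j)) /\
  is_metric A d /\
  translation_invariant A d /\
  (forall U, seminorm_open A P p U <-> metric_open A d U) /\
  is_complete A d.

(* Main.v *)
Require Import Defs.
From Stdlib Require Import Reals Lra Lia List ClassicalEpsilon FunctionalExtensionality.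
From Coquelicot Require Import Coquelicot.
Open Scope R_scope.

(** Goursat's lemma gives a holomorphic function [f] local primitives [F' = f] and [G' = F].
    The formula [2 pi r F(z) = int G(z + r e^{it}) e^{-it} dt] holds because [G] is twice
    continuously differentiable; differentiating it twice in [z] under the integral sign yields
    [2 pi r f'(z) = int f(z + r e^{it}) e^{-it} dt], hence Cauchy's estimate and the
    holomorphy of [f'], and then the holomorphy of locally uniform limits together with the
    locally uniform convergence of all derivatives.

    For a Cauchy sequence in the space, the derivatives of order [min F] converge locally
    uniformly on [Omega].  Integrating on discs, and spreading convergence from the base points
    over the components by connectedness, the same holds for all lower orders down to [0].  The
    limit belongs to the space because the extensions of the derivatives of order in [F]
    converge uniformly on bounded parts of the closure.  The same descent, applied to zero
    derivatives, shows that the seminorms separate points; the remaining assertions hold for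
    every countable separating family of seminorms. *)

(** * Complex differentiability and curves *)

(** Circles are translated with [z] instead of being kept fixed, so the formula has no singular
    kernel: differentiation in [z] falls on the function, and a first-order expansion that is
    uniform on a disc suffices. Such an expansion needs a continuous derivative, and at the outset
    that of [f] is not known to be continuous, whence two primitives rather than one.

    A seminorm at a base point, of order below [min F], fixes for its order the constant of
    integration on one component, which is what the next derivative leaves open. Orders above
    [min F] outside [F] are controlled by no seminorm; on [Omega] all derivatives converge locally
    uniformly once the functions do, and this also identifies the limits of the extensions with the
    derivatives of the limit.

    [extension] is a choice among functions on [C], so its linearity is available on the closure of
    [Omega] only, where density determines it; the sup seminorms look at no other points. *)

(** The uniform structure on [C] is coordinatewise; its balls and the discs of the modulus are
    comparable up to the factor [sqrt 2]. *)
Lemma C_locally (z : C) (P : C -> Prop) :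
  locally z P <-> exists d, 0 < d /\ forall w, Cmod (w - z) < d -> P w.
Proof.
  split.
  - intros [d Hd]; exists d; split; [apply cond_pos|].
    intros w Hw; apply Hd, C_NormedModule_mixin_compat1, Hw.
  - intros [d [Hd H]].
    assert (Hs : 0 < sqrt 2) by (apply sqrt_lt_R0; lra).
    assert (Hd' : 0 < d / sqrt 2) by (apply Rdiv_lt_0_compat; lra).
    exists (mkposreal _ Hd'); intros w Hw; apply H.
    apply (C_NormedModule_mixin_compat2 z w) in Hw; simpl in Hw.
    replace (sqrt 2 * (d / sqrt 2)) with d in Hw by (field; lra).
    exact Hw.
Qed.

Lemma C_open (U : C -> Prop) :
  open U <-> forall z, U z -> exists d, 0 < d /\ forall w, Cmod (w - z) < d -> U w.
Proof.
  split; intros H z Hz; apply C_locally, H, Hz.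
Qed.

Lemma Cmod_sym (x y : C) : Cmod (x - y) = Cmod (y - x).
Proof. rewrite <- Cmod_opp; f_equal; ring. Qed.

Lemma Cmod_minus_triangle (x y z : C) : Cmod (x - z) <= Cmod (x - y) + Cmod (y - z).
Proof. replace (x - z)%C with ((x - y) + (y - z))%C by ring; apply Cmod_triangle. Qed.

Lemma Cmod_le_eps_0 (x : C) : (forall eps, 0 < eps -> Cmod x <= eps) -> x = 0%C.
Proof.
  intros H; apply Cmod_eq_0; destruct (Cmod_ge_0 x) as [Hx|Hx]; [|easy].
  specialize (H (Cmod x / 2)); lra.
Qed.

Definition C_cont (f : C -> C) (z : C) : Prop :=
  forall eps, 0 < eps -> exists d, 0 < d /\
    forall w, Cmod (w - z) < d -> Cmod (f w - f z) <= eps.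

(** The bound is non-strict since [w = z] is allowed, where both sides vanish. *)
Definition C_diff (f : C -> C) (z l : C) : Prop :=
  forall eps, 0 < eps -> exists d, 0 < d /\
    forall w, Cmod (w - z) < d -> Cmod (f w - f z - l * (w - z)) <= eps * Cmod (w - z).

Lemma is_derive_C_diff (f : C -> C) (z l : C) : is_derive f z l <-> C_diff f z l.
Proof.
  split.
  - intros [_ H] eps Heps.
    destruct (H z (fun P HP => HP) (mkposreal eps Heps)) as [d Hd].
    exists d; split; [apply cond_pos|]; intros w Hw.
    specialize (Hd w Hw); simpl in Hd.
    replace (l * (w - z))%C with ((w - z) * l)%C by ring; exact Hd.
  - intros H; split; [apply is_linear_scal_l|].
    intros x Hx; apply (is_filter_lim_locally_unique (V := AbsRing_NormedModule C_AbsRing)) in Hx; subst x.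
    intros eps; destruct (H eps (cond_pos eps)) as [d [Hd Hd']].
    exists (mkposreal d Hd); intros w Hw.
    specialize (Hd' w Hw).
    replace (l * (w - z))%C with ((w - z) * l)%C in Hd' by ring; exact Hd'.
Qed.

Lemma C_derive_eq (f : C -> C) (z l : C) : C_diff f z l -> C_derive f z = l.
Proof. intros H; apply is_C_derive_unique, is_derive_C_diff, H. Qed.

Lemma ex_derive_C_diff (f : C -> C) (z : C) :
  ex_derive f z -> C_diff f z (C_derive f z).
Proof. intros H; apply is_derive_C_diff, C_derive_correct; auto. Qed.

Lemma C_diff_ex_derive (f : C -> C) (z l : C) : C_diff f z l -> ex_derive f z.
Proof. intros H; exists l; apply is_derive_C_diff, H. Qed.

Lemma C_diff_ext (f g : C -> C) (z l : C) (d : R) :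
  0 < d -> (forall w, Cmod (w - z) < d -> f w = g w) -> C_diff f z l -> C_diff g z l.
Proof.
  intros Hd Hfg Hf eps Heps; destruct (Hf eps Heps) as [d' [Hd' H]].
  exists (Rmin d d'); split; [apply Rmin_pos; auto|]; intros w Hw.
  rewrite <- !Hfg.
  - apply H; eapply Rlt_le_trans; [apply Hw|apply Rmin_r].
  - replace (z - z)%C with (RtoC 0) by ring; rewrite Cmod_0; auto.
  - eapply Rlt_le_trans; [apply Hw|apply Rmin_l].
Qed.

Lemma C_diff_plus (f g : C -> C) (z a b : C) :
  C_diff f z a -> C_diff g z b -> C_diff (fun w => f w + g w)%C z (a + b)%C.
Proof.
  intros Hf Hg eps Heps.
  destruct (Hf (eps / 2)) as [d [Hd H]]; [lra|].
  destruct (Hg (eps / 2)) as [d' [Hd' H']]; [lra|].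
  exists (Rmin d d'); split; [apply Rmin_pos; auto|]; intros w Hw.
  assert (H1 := H w (Rlt_le_trans _ _ _ Hw (Rmin_l _ _))).
  assert (H2 := H' w (Rlt_le_trans _ _ _ Hw (Rmin_r _ _))).
  replace (f w + g w - (f z + g z) - (a + b) * (w - z))%C
    with ((f w - f z - a * (w - z)) + (g w - g z - b * (w - z)))%C by ring.
  eapply Rle_trans; [apply Cmod_triangle|]; lra.
Qed.

Lemma C_diff_scal (c : C) (f : C -> C) (z a : C) :
  C_diff f z a -> C_diff (fun w => c * f w)%C z (c * a)%C.
Proof.
  intros Hf eps Heps.
  assert (Hc := Cmod_ge_0 c).
  destruct (Hf (eps / (1 + Cmod c))) as [d [Hd H]]; [apply Rdiv_lt_0_compat; lra|].
  exists d; split; auto; intros w Hw; specialize (H w Hw).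
  replace (c * f w - c * f z - c * a * (w - z))%C
    with (c * (f w - f z - a * (w - z)))%C by ring.
  rewrite Cmod_mult.
  apply Rle_trans with (Cmod c * (eps / (1 + Cmod c) * Cmod (w - z))).
  - apply Rmult_le_compat_l; auto.
  - replace (Cmod c * (eps / (1 + Cmod c) * Cmod (w - z)))
      with ((Cmod c / (1 + Cmod c)) * (eps * Cmod (w - z))) by (field; lra).
    rewrite <- (Rmult_1_l (eps * Cmod (w - z))) at 2.
    apply Rmult_le_compat_r.
    + apply Rmult_le_pos; [lra|apply Cmod_ge_0].
    + apply (Rmult_le_reg_r (1 + Cmod c)); [lra|]; field_simplify; lra.
Qed.

Lemma C_diff_minus (f g : C -> C) (z a b : C) :
  C_diff f z a -> C_diff g z b -> C_diff (fun w => f w - g w)%C z (a - b)%C.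
Proof.
  intros Hf Hg.
  replace (a - b)%C with (a + (-1) * b)%C by ring.
  apply (C_diff_ext (fun w => f w + (-1) * g w)%C _ _ _ 1); [lra|intros; ring|].
  apply C_diff_plus; auto; apply C_diff_scal; auto.
Qed.

(** Through this primitive the integral of an affine function over a triangle vanishes. *)
Lemma C_diff_quadratic (a b z : C) :
  C_diff (fun w => a * w + b * (w * w))%C z (a + 2 * b * z)%C.
Proof.
  intros eps Heps; assert (Hb := Cmod_ge_0 b).
  exists (eps / (1 + Cmod b)); split; [apply Rdiv_lt_0_compat; lra|]; intros w Hw.
  replace (a * w + b * (w * w) - (a * z + b * (z * z)) - (a + 2 * b * z) * (w - z))%C
    with (b * (w - z) * (w - z))%C by ring.
  rewrite !Cmod_mult; apply Rmult_le_compat_r; [apply Cmod_ge_0|].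
  apply Rmult_lt_compat_l with (r := 1 + Cmod b) in Hw; [|lra].
  replace ((1 + Cmod b) * (eps / (1 + Cmod b))) with eps in Hw by (field; lra).
  assert (Hw' := Cmod_ge_0 (w - z)); nra.
Qed.

Lemma C_diff_cont (f : C -> C) (z l : C) : C_diff f z l -> C_cont f z.
Proof.
  intros Hf eps Heps; destruct (Hf 1) as [d [Hd H]]; [lra|].
  assert (Hl := Cmod_ge_0 l).
  exists (Rmin d (eps / (1 + Cmod l))); split.
  { apply Rmin_pos; auto; apply Rdiv_lt_0_compat; lra. }
  intros w Hw.
  assert (H1 := H w (Rlt_le_trans _ _ _ Hw (Rmin_l _ _))).
  assert (H2 := Rlt_le_trans _ _ _ Hw (Rmin_r _ _)).
  apply Rmult_lt_compat_l with (r := 1 + Cmod l) in H2; [|lra].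
  replace ((1 + Cmod l) * (eps / (1 + Cmod l))) with eps in H2 by (field; lra).
  replace (f w - f z)%C with ((f w - f z - l * (w - z)) + l * (w - z))%C by ring.
  eapply Rle_trans; [apply Cmod_triangle|]; rewrite (Cmod_mult l); lra.
Qed.

(** * Curves in the plane with a real parameter *)

Definition curve_cont (g : R -> C) (t : R) : Prop :=
  forall eps, 0 < eps -> exists d, 0 < d /\
    forall s, Rabs (s - t) < d -> Cmod (g s - g t) <= eps.

Lemma curve_cont_continuous (g : R -> C) (t : R) :
  curve_cont g t -> continuous (U := C_R_CompleteNormedModule) g t.
Proof.
  intros H P HP; apply C_locally in HP; destruct HP as [eps [Heps HP]].
  destruct (H (eps / 2)) as [d [Hd H']]; [lra|].
  exists (mkposreal d Hd); intros s Hs; apply HP.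
  apply Rle_lt_trans with (eps / 2); [|lra]; apply H', Hs.
Qed.

Definition curve_diff (g : R -> C) (t : R) (v : C) : Prop :=
  forall eps, 0 < eps -> exists d, 0 < d /\
    forall s, Rabs (s - t) < d -> Cmod (g s - g t - (s - t)%R * v) <= eps * Rabs (s - t).

Lemma curve_diff_is_derive (g : R -> C) (t : R) (v : C) :
  curve_diff g t v -> is_derive (V := C_R_CompleteNormedModule) g t v.
Proof.
  intros H; split; [apply is_linear_scal_l|].
  intros x Hx; apply (is_filter_lim_locally_unique (V := AbsRing_NormedModule R_AbsRing)) in Hx; subst x.
  intros eps; destruct (H eps (cond_pos eps)) as [d [Hd Hd']].
  exists (mkposreal d Hd); intros w Hw; specialize (Hd' w Hw).
  rewrite <- scal_R_Cmult, Cmod_norm in Hd'; exact Hd'.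
Qed.

Lemma curve_diff_cont (g : R -> C) (t : R) (v : C) : curve_diff g t v -> curve_cont g t.
Proof.
  intros Hf eps Heps; destruct (Hf 1) as [d [Hd H]]; [lra|].
  assert (Hl := Cmod_ge_0 v).
  exists (Rmin d (eps / (1 + Cmod v))); split.
  { apply Rmin_pos; auto; apply Rdiv_lt_0_compat; lra. }
  intros w Hw.
  assert (H1 := H w (Rlt_le_trans _ _ _ Hw (Rmin_l _ _))).
  assert (H2 := Rlt_le_trans _ _ _ Hw (Rmin_r _ _)).
  apply Rmult_lt_compat_l with (r := 1 + Cmod v) in H2; [|lra].
  replace ((1 + Cmod v) * (eps / (1 + Cmod v))) with eps in H2 by (field; lra).
  replace (g w - g t)%C with ((g w - g t - (w - t)%R * v) + (w - t)%R * v)%C by ring.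
  eapply Rle_trans; [apply Cmod_triangle|]; rewrite (Cmod_mult _ v), Cmod_R; lra.
Qed.

Lemma C_diff_comp_curve (f : C -> C) (g : R -> C) (t : R) (l v : C) :
  C_diff f (g t) l -> curve_diff g t v -> curve_diff (fun s => f (g s)) t (l * v).
Proof.
  intros Hf Hg eps Heps.
  assert (Hl := Cmod_ge_0 l); assert (Hv := Cmod_ge_0 v).
  destruct (Hf (eps / (2 * (1 + Cmod v)))) as [d [Hd H]]; [apply Rdiv_lt_0_compat; lra|].
  (* The bound 1 gives [Cmod (g s - g t) <= (1 + Cmod v) * Rabs (s - t)]; the other bound pays for
     the factor [Cmod l]. *)
  destruct (Hg (Rmin 1 (eps / (2 * (1 + Cmod l))))) as [d' [Hd' H']].
  { apply Rmin_pos; [lra|apply Rdiv_lt_0_compat; lra]. }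
  destruct (curve_diff_cont _ _ _ Hg (d / 2)) as [d2 [Hd2 H2]]; [lra|].
  exists (Rmin d' d2); split; [apply Rmin_pos; auto|]; intros s Hs.
  assert (H3 := H' s (Rlt_le_trans _ _ _ Hs (Rmin_l _ _))).
  assert (H4 := H2 s (Rlt_le_trans _ _ _ Hs (Rmin_r _ _))).
  assert (H5 := H (g s) ltac:(lra)).
  assert (Hst := Rabs_pos (s - t)).
  replace (f (g s) - f (g t) - (s - t)%R * (l * v))%C
    with ((f (g s) - f (g t) - l * (g s - g t)) + l * (g s - g t - (s - t)%R * v))%C by ring.
  eapply Rle_trans; [apply Cmod_triangle|]; rewrite (Cmod_mult l).
  assert (H6 : Cmod (g s - g t) <= (1 + Cmod v) * Rabs (s - t)).
  { replace (g s - g t)%C with ((g s - g t - (s - t)%R * v) + (s - t)%R * v)%C by ring.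
    eapply Rle_trans; [apply Cmod_triangle|]; rewrite (Cmod_mult _ v), Cmod_R.
    assert (Rmin 1 (eps / (2 * (1 + Cmod l))) * Rabs (s - t) <= 1 * Rabs (s - t))
      by (apply Rmult_le_compat_r; [auto|apply Rmin_l]); lra. }
  assert (H7 : Cmod (g s - g t - (s - t)%R * v) <= eps / (2 * (1 + Cmod l)) * Rabs (s - t)).
  { eapply Rle_trans; [apply H3|]; apply Rmult_le_compat_r; [auto|apply Rmin_r]. }
  assert (H8 : eps / (2 * (1 + Cmod v)) * Cmod (g s - g t) <= eps / 2 * Rabs (s - t)).
  { apply Rle_trans with (eps / (2 * (1 + Cmod v)) * ((1 + Cmod v) * Rabs (s - t))).
    - apply Rmult_le_compat_l; auto.
      left; apply Rdiv_lt_0_compat; lra.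
    - right; field; lra. }
  assert (H9 : Cmod l * Cmod (g s - g t - (s - t)%R * v) <= eps / 2 * Rabs (s - t)).
  { apply Rle_trans with ((1 + Cmod l) * (eps / (2 * (1 + Cmod l)) * Rabs (s - t))).
    - apply Rmult_le_compat; auto; try lra; apply Cmod_ge_0.
    - right; field; lra. }
  lra.
Qed.

Lemma C_cont_comp_curve (f : C -> C) (g : R -> C) (t : R) :
  C_cont f (g t) -> curve_cont g t -> curve_cont (fun s => f (g s)) t.
Proof.
  intros Hf Hg eps Heps; destruct (Hf eps Heps) as [d [Hd H]].
  destruct (Hg (d / 2)) as [d' [Hd' H']]; [lra|].
  exists d'; split; auto; intros s Hs; apply H.
  specialize (H' s Hs); lra.
Qed.

Lemma curve_cont_const (c : C) (t : R) : curve_cont (fun _ => c) t.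
Proof.
  intros eps Heps; exists 1; split; [lra|]; intros s _.
  replace (c - c)%C with (RtoC 0) by ring; rewrite Cmod_0; lra.
Qed.

Lemma curve_cont_plus (f g : R -> C) (t : R) :
  curve_cont f t -> curve_cont g t -> curve_cont (fun s => f s + g s)%C t.
Proof.
  intros Hf Hg eps Heps.
  destruct (Hf (eps / 2)) as [d [Hd H]]; [lra|].
  destruct (Hg (eps / 2)) as [d' [Hd' H']]; [lra|].
  exists (Rmin d d'); split; [apply Rmin_pos; auto|]; intros s Hs.
  assert (H1 := H s (Rlt_le_trans _ _ _ Hs (Rmin_l _ _))).
  assert (H2 := H' s (Rlt_le_trans _ _ _ Hs (Rmin_r _ _))).
  replace (f s + g s - (f t + g t))%C with ((f s - f t) + (g s - g t))%C by ring.
  eapply Rle_trans; [apply Cmod_triangle|]; lra.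
Qed.

Lemma curve_cont_mult (f g : R -> C) (t : R) :
  curve_cont f t -> curve_cont g t -> curve_cont (fun s => f s * g s)%C t.
Proof.
  intros Hf Hg eps Heps.
  assert (Hft := Cmod_ge_0 (f t)); assert (Hgt := Cmod_ge_0 (g t)).
  (* Each of the three products in the expansion of the difference is at most [eps / k] times a
     factor bounded by 1, [Cmod (g t)] or [Cmod (f t)]. *)
  set (k := 2 * (2 + Cmod (f t) + Cmod (g t))).
  assert (Hk : 0 < eps / k) by (apply Rdiv_lt_0_compat; unfold k; lra).
  destruct (Hf (Rmin 1 (eps / k))) as [d [Hd H]]; [apply Rmin_pos; lra|].
  destruct (Hg (eps / k)) as [d' [Hd' H']]; [lra|].
  exists (Rmin d d'); split; [apply Rmin_pos; auto|]; intros s Hs.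
  assert (H1 := H s (Rlt_le_trans _ _ _ Hs (Rmin_l _ _))).
  assert (H2 := H' s (Rlt_le_trans _ _ _ Hs (Rmin_r _ _))).
  assert (H3 := Rle_trans _ _ _ H1 (Rmin_l _ _)).
  assert (H4 := Rle_trans _ _ _ H1 (Rmin_r _ _)).
  replace (f s * g s - f t * g t)%C
    with ((f s - f t) * (g s - g t) + (f s - f t) * g t + f t * (g s - g t))%C by ring.
  eapply Rle_trans; [apply Cmod_triangle|].
  assert (H5 := Cmod_triangle ((f s - f t) * (g s - g t)) ((f s - f t) * g t)).
  rewrite !Cmod_mult in *.
  assert (H6 := Cmod_ge_0 (f s - f t)); assert (H7 := Cmod_ge_0 (g s - g t)).
  assert (H8 : k * (eps / k) = eps) by (field; unfold k; lra).
  unfold k at 1 in H8; nra.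
Qed.

Lemma curve_diff_affine (a b : C) (t : R) : curve_diff (fun s => a + s * b)%C t b.
Proof.
  intros eps Heps; exists 1; split; [lra|]; intros s _.
  replace (a + s * b - (a + t * b) - (s - t)%R * b)%C with (RtoC 0)
    by (rewrite RtoC_minus; ring).
  rewrite Cmod_0; apply Rmult_le_pos; [lra|apply Rabs_pos].
Qed.

(** * Integrals along curves and segments *)

(** [C] is taken as a real normed module, as integration in a real variable requires. *)
Definition CInt (f : R -> C) (a b : R) : C := RInt (V := C_R_CompleteNormedModule) f a b.

Definition cont_between (f : R -> C) (a b : R) : Prop :=
  forall t, a <= t <= b -> curve_cont f t.

Lemma CInt_correct (f : R -> C) (a b : R) :
  a <= b -> cont_between f a b -> is_RInt (V := C_R_NormedModule) f a b (CInt f a b).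
Proof.
  intros Hab H; apply (RInt_correct (V := C_R_CompleteNormedModule)).
  apply (ex_RInt_continuous (V := C_R_CompleteNormedModule)).
  rewrite Rmin_left, Rmax_right by auto.
  intros t Ht; apply curve_cont_continuous; auto.
Qed.

Lemma CInt_unique (f : R -> C) (a b : R) (l : C) :
  is_RInt (V := C_R_NormedModule) f a b l -> CInt f a b = l.
Proof. apply (is_RInt_unique (V := C_R_CompleteNormedModule)). Qed.

Lemma CInt_ext (f g : R -> C) (a b : R) :
  a <= b -> (forall t, a <= t <= b -> f t = g t) -> CInt f a b = CInt g a b.
Proof.
  intros Hab H; apply (RInt_ext (V := C_R_CompleteNormedModule)).
  rewrite Rmin_left, Rmax_right by auto; intros t Ht; apply H; lra.
Qed.

Lemma CInt_minus (f g : R -> C) (a b : R) :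
  a <= b -> cont_between f a b -> cont_between g a b ->
  CInt (fun t => f t - g t)%C a b = (CInt f a b - CInt g a b)%C.
Proof.
  intros Hab Hf Hg; apply CInt_unique.
  apply (is_RInt_minus (V := C_R_NormedModule)); apply CInt_correct; auto.
Qed.

(** Integration is linear over [R] by construction; a complex factor is handled through the
    coordinates of the product. *)
Lemma CInt_scal (c : C) (f : R -> C) (a b : R) :
  a <= b -> cont_between f a b -> CInt (fun t => c * f t)%C a b = (c * CInt f a b)%C.
Proof.
  intros Hab Hf; apply CInt_unique.
  assert (H := CInt_correct f a b Hab Hf).
  assert (H1 := is_RInt_fct_extend_fst (U := R_NormedModule) (V := R_NormedModule) _ _ _ _ H).
  assert (H2 := is_RInt_fct_extend_snd (U := R_NormedModule) (V := R_NormedModule) _ _ _ _ H).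
  apply (is_RInt_fct_extend_pair (U := R_NormedModule) (V := R_NormedModule)).
  - apply (is_RInt_minus (V := R_NormedModule)); apply (is_RInt_scal (V := R_NormedModule)); auto.
  - apply (is_RInt_plus (V := R_NormedModule)); apply (is_RInt_scal (V := R_NormedModule)); auto.
Qed.

Lemma CInt_const (c : C) (a b : R) : CInt (fun _ => c) a b = ((b - a)%R * c)%C.
Proof.
  unfold CInt; rewrite (RInt_const (V := C_R_CompleteNormedModule)).
  apply scal_R_Cmult.
Qed.

Lemma CInt_bound (f : R -> C) (a b M : R) :
  a <= b -> cont_between f a b -> (forall t, a <= t <= b -> Cmod (f t) <= M) ->
  Cmod (CInt f a b) <= (b - a) * M.
Proof.
  intros Hab Hf HM; rewrite Cmod_norm.
  apply (norm_RInt_le_const (V := C_R_NormedModule) f a b); auto.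
  - intros t Ht; rewrite <- Cmod_norm; auto.
  - apply CInt_correct; auto.
Qed.

Lemma CInt_derive (f df : R -> C) (a b : R) :
  a <= b -> (forall t, a <= t <= b -> curve_diff f t (df t)) -> cont_between df a b ->
  CInt df a b = (f b - f a)%C.
Proof.
  intros Hab Hf Hdf; apply CInt_unique.
  apply (is_RInt_derive (V := C_R_CompleteNormedModule));
    rewrite Rmin_left, Rmax_right by auto; intros t Ht.
  - apply curve_diff_is_derive; auto.
  - apply curve_cont_continuous; auto.
Qed.

Lemma CInt_Chasles (f : R -> C) (a b c : R) :
  a <= b -> b <= c -> cont_between f a c ->
  CInt f a c = (CInt f a b + CInt f b c)%C.
Proof.
  intros Hab Hbc H; apply CInt_unique.
  apply (is_RInt_Chasles (V := C_R_NormedModule)) with b; apply CInt_correct; auto;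
    intros t Ht; apply H; lra.
Qed.

(** * Integrals over segments *)

Definition segment_point (a b : C) (t : R) : C := (a + t * (b - a))%C.

Definition segment_integral (f : C -> C) (a b : C) : C :=
  ((b - a) * CInt (fun t => f (segment_point a b t)) 0 1)%C.

Definition convex (D : C -> Prop) : Prop :=
  forall a b t, D a -> D b -> 0 <= t <= 1 -> D (segment_point a b t).

(** Continuity is that of [f] as a function on [C], not relative to [D]. *)
Definition cont_on_set (D : C -> Prop) (f : C -> C) : Prop := forall z, D z -> C_cont f z.

Lemma segment_point_diff (a b : C) (t : R) : curve_diff (segment_point a b) t (b - a)%C.
Proof. apply curve_diff_affine. Qed.

Lemma segment_cont (D : C -> Prop) (f : C -> C) (a b : C) :
  convex D -> cont_on_set D f -> D a -> D b ->
  cont_between (fun t => f (segment_point a b t)) 0 1.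
Proof.
  intros HD Hf Ha Hb t Ht; apply C_cont_comp_curve.
  - apply Hf, HD; auto.
  - apply curve_diff_cont with (b - a)%C; apply segment_point_diff.
Qed.

Lemma segment_integral_bound (D : C -> Prop) (f : C -> C) (a b : C) (M : R) :
  convex D -> cont_on_set D f -> D a -> D b ->
  (forall t, 0 <= t <= 1 -> Cmod (f (segment_point a b t)) <= M) ->
  Cmod (segment_integral f a b) <= Cmod (b - a) * M.
Proof.
  intros HD Hf Ha Hb HM; unfold segment_integral; rewrite Cmod_mult.
  apply Rmult_le_compat_l; [apply Cmod_ge_0|].
  eapply Rle_trans; [apply CInt_bound with (M := M)|]; try lra.
  - apply segment_cont with D; auto.
  - auto.
Qed.

Lemma segment_integral_minus (D : C -> Prop) (f g : C -> C) (a b : C) :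
  convex D -> cont_on_set D f -> cont_on_set D g -> D a -> D b ->
  segment_integral (fun w => f w - g w)%C a b =
  (segment_integral f a b - segment_integral g a b)%C.
Proof.
  intros HD Hf Hg Ha Hb; unfold segment_integral.
  rewrite (CInt_minus (fun t => f (segment_point a b t)) (fun t => g (segment_point a b t)));
    [ring|lra| |]; apply segment_cont with D; auto.
Qed.

Lemma segment_integral_derive (D : C -> Prop) (F f : C -> C) (a b : C) :
  convex D -> cont_on_set D f -> (forall z, D z -> C_diff F z (f z)) -> D a -> D b ->
  segment_integral f a b = (F b - F a)%C.
Proof.
  intros HD Hf HF Ha Hb; unfold segment_integral.
  rewrite <- CInt_scal by (lra || apply segment_cont with D; auto).
  rewrite (CInt_derive (fun t => F (segment_point a b t))).
  - unfold segment_point; f_equal; [|f_equal]; f_equal; ring.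
  - lra.
  - intros t Ht; rewrite Cmult_comm.
    apply C_diff_comp_curve; [apply HF, HD; auto|apply segment_point_diff].
  - intros t Ht; apply curve_cont_mult; [apply curve_cont_const|].
    apply (segment_cont D f a b); auto.
Qed.

Lemma CInt_comp_lin (f : R -> C) (u v : R) (l : C) :
  is_RInt (V := C_R_NormedModule) f v (u + v) l ->
  CInt (fun t => u * f (u * t + v)%R)%C 0 1 = l.
Proof.
  intros H; apply CInt_unique.
  eapply (is_RInt_ext (V := C_R_NormedModule)).
  - intros t _; apply scal_R_Cmult.
  - apply (is_RInt_comp_lin (V := C_R_NormedModule)).
    replace (u * 0 + v) with v by ring; replace (u * 1 + v) with (u + v) by ring; exact H.
Qed.

(** The parameter integral is unchanged under [t -> 1 - t]; the sign comes from the factor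
    [b - a]. *)
Lemma segment_integral_swap (D : C -> Prop) (f : C -> C) (a b : C) :
  convex D -> cont_on_set D f -> D a -> D b ->
  segment_integral f b a = (- segment_integral f a b)%C.
Proof.
  intros HD Hf Ha Hb; unfold segment_integral.
  assert (H := CInt_correct _ 0 1 Rle_0_1 (segment_cont D f a b HD Hf Ha Hb)).
  apply (is_RInt_swap (V := C_R_NormedModule)) in H.
  set (I := CInt (fun t => f (segment_point a b t)) 0 1) in *.
  replace (CInt (fun t => f (segment_point b a t)) 0 1) with I; [ring|].
  replace I with (- - I)%C by ring.
  rewrite <- (CInt_comp_lin (fun t => f (segment_point a b t)) (-1) 1 (- I)%C).
  - replace (- CInt (fun t => (-1)%R * f (segment_point a b (-1 * t + 1)%R))%C 0 1)%C
      with ((-1)%R * CInt (fun t => (-1)%R * f (segment_point a b (-1 * t + 1)%R))%C 0 1)%C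
      by ring.
    rewrite <- CInt_scal.
    + apply CInt_ext; [lra|]; intros t _.
      replace (segment_point a b (-1 * t + 1)) with (segment_point b a t).
      * ring.
      * unfold segment_point; rewrite RtoC_plus, RtoC_mult; ring.
    + lra.
    + intros t Ht; apply curve_cont_mult; [apply curve_cont_const|].
      replace (fun s => f (segment_point a b (-1 * s + 1)))
        with (fun s => f (segment_point b a s)).
      * apply (segment_cont D f b a); auto.
      * apply functional_extensionality; intros s; f_equal.
        unfold segment_point; rewrite RtoC_plus, RtoC_mult; ring.
  - replace (-1 + 1) with 0 by ring; exact H.
Qed.

(** Each half is rescaled to [[0, 1]], and the factor 1/2 is absorbed into [m - a] and [b - m]. *)
Lemma segment_integral_split (D : C -> Prop) (f : C -> C) (a b m : C) :
  convex D -> cont_on_set D f -> D a -> D b -> m = segment_point a b (1 / 2) ->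
  segment_integral f a b = (segment_integral f a m + segment_integral f m b)%C.
Proof.
  intros HD Hf Ha Hb Hm; unfold segment_integral.
  assert (Hg := segment_cont D f a b HD Hf Ha Hb).
  set (g := fun t => f (segment_point a b t)) in *.
  rewrite (CInt_Chasles g 0 (1 / 2) 1) by (lra || auto).
  assert (H1 : is_RInt (V := C_R_NormedModule) g 0 (1 / 2 + 0) (CInt g 0 (1 / 2))).
  { rewrite Rplus_0_r; apply CInt_correct; [lra|]; intros t Ht; apply Hg; lra. }
  assert (H2 : is_RInt (V := C_R_NormedModule) g (1 / 2) (1 / 2 + 1 / 2) (CInt g (1 / 2) 1)).
  { replace (1 / 2 + 1 / 2) with 1 by lra.
    apply CInt_correct; [lra|]; intros t Ht; apply Hg; lra. }
  apply CInt_comp_lin in H1; apply CInt_comp_lin in H2.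
  assert (Hm' : (m = a + (/ 2)%R * (b - a))%C)
    by (rewrite Hm; unfold segment_point; repeat f_equal; lra).
  assert (Dm : D m) by (rewrite Hm; apply HD; auto; lra).
  rewrite <- H1, <- H2.
  assert (E1 : forall t, f (segment_point a m t) = g (1 / 2 * t + 0)).
  { intros t; unfold g; f_equal; unfold segment_point; rewrite Hm'.
    replace (1 / 2 * t + 0) with (t * / 2) by field; rewrite RtoC_mult; ring. }
  assert (E2 : forall t, f (segment_point m b t) = g (1 / 2 * t + 1 / 2)).
  { intros t; unfold g; f_equal; unfold segment_point; rewrite Hm'.
    replace (1 / 2 * t + 1 / 2) with (/ 2 + t * / 2) by field.
    rewrite RtoC_plus, RtoC_mult.
    assert (E : (RtoC (/ 2) + RtoC (/ 2) = 1)%C)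
      by (rewrite <- RtoC_plus; f_equal; lra).
    replace (a + (/ 2)%R * (b - a) + t * (b - (a + (/ 2)%R * (b - a))))%C
      with (a + (/ 2)%R * (b - a) + t * ((RtoC (/ 2) + RtoC (/ 2)) * (b - a) - (/ 2)%R * (b - a)))%C
      by (rewrite E; ring); ring. }
  rewrite (CInt_ext (fun t => (1 / 2)%R * g (1 / 2 * t + 0)%R)%C
             (fun t => (1 / 2)%R * f (segment_point a m t))%C)
    by (lra || intros; rewrite E1; auto).
  rewrite (CInt_ext (fun t => (1 / 2)%R * g (1 / 2 * t + 1 / 2)%R)%C
             (fun t => (1 / 2)%R * f (segment_point m b t))%C)
    by (lra || intros; rewrite E2; auto).
  rewrite !CInt_scal by (lra || apply segment_cont with D; auto).
  replace (1 / 2) with (/ 2) by field.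
  assert (Hma : (m - a = (/ 2)%R * (b - a))%C) by (rewrite Hm'; ring).
  assert (Hbm : (b - m = (/ 2)%R * (b - a))%C).
  { rewrite Hm'; assert (E : (RtoC (/ 2) + RtoC (/ 2) = 1)%C)
      by (rewrite <- RtoC_plus; f_equal; lra).
    replace (b - (a + (/ 2)%R * (b - a)))%C
      with ((RtoC (/ 2) + RtoC (/ 2)) * (b - a) - (/ 2)%R * (b - a))%C by (rewrite E; ring).
    ring. }
  rewrite Hma, Hbm; ring.
Qed.

(** * Goursat's lemma *)

Lemma RtoC_2_neq_0 : RtoC 2 <> 0.
Proof. intros H; apply RtoC_inj in H; lra. Qed.

Lemma Cmod_half (z : C) : Cmod (z / 2) = Cmod z / 2.
Proof. rewrite Cmod_div by exact RtoC_2_neq_0; rewrite Cmod_R, Rabs_pos_eq; lra. Qed.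

Lemma segment_point_half (a b : C) : segment_point a b (1 / 2) = ((a + b) / 2)%C.
Proof.
  unfold segment_point; rewrite RtoC_div by lra; field; exact RtoC_2_neq_0.
Qed.

Definition triangle : Type := (C * C * C)%type.

Definition in_set (D : C -> Prop) (T : triangle) : Prop :=
  let '(a, b, c) := T in D a /\ D b /\ D c.

Definition corner (T : triangle) : C := fst (fst T).

Definition perimeter (T : triangle) : R :=
  let '(a, b, c) := T in Cmod (b - a) + Cmod (c - b) + Cmod (a - c).

Definition triangle_integral (f : C -> C) (T : triangle) : C :=
  let '(a, b, c) := T in
  (segment_integral f a b + segment_integral f b c + segment_integral f c a)%C.

(** The vertices are ordered so that all four triangles carry the orientation of [T]: each inner
    side is then traversed once in each direction, and the inner contributions cancel. *)
Definition subtriangles (T : triangle) : list triangle :=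
  let '(a, b, c) := T in
  let p := ((a + b) / 2)%C in let q := ((b + c) / 2)%C in let r := ((c + a) / 2)%C in
  ((a, p, r) :: (p, b, q) :: (r, q, c) :: (q, r, p) :: nil)%list.

(** Halving perimeters, together with a corner that moves by at most one perimeter, make the corners
    of nested triangles a Cauchy sequence. *)
Lemma subtriangles_geometry (D : C -> Prop) (T S : triangle) :
  convex D -> in_set D T -> In S (subtriangles T) ->
  in_set D S /\ perimeter S = perimeter T / 2 /\ Cmod (corner S - corner T) <= perimeter T.
Proof.
  destruct T as [[a b] c]; intros HD [Ha [Hb Hc]] HS.
  assert (Hmid : forall x y, D x -> D y -> D ((x + y) / 2)%C).
  { intros x y Hx Hy; rewrite <- segment_point_half; apply HD; auto; lra. }
  assert (Hab := Cmod_ge_0 (b - a)); assert (Hbc := Cmod_ge_0 (c - b));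
    assert (Hca := Cmod_ge_0 (a - c)).
  assert (Hq := Cmod_minus_triangle ((b + c) / 2) b a).
  assert (E0 : Cmod ((b + c) / 2 - b) = Cmod (c - b) / 2).
  { rewrite <- Cmod_half; f_equal; field; exact RtoC_2_neq_0. }
  assert (E1 : Cmod ((c + a) / 2 - a) = Cmod (a - c) / 2).
  { rewrite <- Cmod_half, <- (Cmod_opp ((a - c) / 2)); f_equal; field; exact RtoC_2_neq_0. }
  assert (E2 : Cmod ((a + b) / 2 - a) = Cmod (b - a) / 2).
  { rewrite <- Cmod_half; f_equal; field; exact RtoC_2_neq_0. }
  assert (half : forall x y u v, (u - v = (x - y) / 2)%C -> Cmod (u - v) = Cmod (x - y) / 2).
  { intros x y u v E; rewrite E; apply Cmod_half. }
  assert (Haa : Cmod (a - a) = 0)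
    by (replace (a - a)%C with (RtoC 0) by ring; apply Cmod_0).
  simpl in HS; destruct HS as [<-|[<-|[<-|[<-|[]]]]]; cbn [in_set corner perimeter fst snd];
    (split; [now auto|split]); try lra.
  1, 2, 3: match goal with |- Cmod (?u - ?v) + Cmod (?u' - ?v') + Cmod (?u'' - ?v'') = _ =>
      rewrite (half b a u v), (half c b u' v'), (half a c u'' v'');
      [lra|field; exact RtoC_2_neq_0..] end.
  (* The sides of the middle triangle are half those of [T] and point the opposite way. *)
  match goal with |- Cmod (?u - ?v) + Cmod (?u' - ?v') + Cmod (?u'' - ?v'') = _ =>
    rewrite (half a b u v), (half b c u' v'), (half c a u'' v'');
    [|field; exact RtoC_2_neq_0..] end.
  rewrite (Cmod_sym a b), (Cmod_sym b c), (Cmod_sym c a); lra.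
Qed.

Lemma triangle_integral_subdivide (D : C -> Prop) (f : C -> C) (T : triangle) :
  convex D -> cont_on_set D f -> in_set D T ->
  triangle_integral f T =
  fold_right (fun S s => triangle_integral f S + s)%C (RtoC 0) (subtriangles T).
Proof.
  destruct T as [[a b] c]; intros HD Hf [Ha [Hb Hc]].
  assert (Hmid : forall x y, D x -> D y -> D ((x + y) / 2)%C).
  { intros x y Hx Hy; rewrite <- segment_point_half; apply HD; auto; lra. }
  simpl.
  rewrite (segment_integral_split D f a b ((a + b) / 2)) by
    (auto; symmetry; apply segment_point_half).
  rewrite (segment_integral_split D f b c ((b + c) / 2)) by
    (auto; symmetry; apply segment_point_half).
  rewrite (segment_integral_split D f c a ((c + a) / 2)) by
    (auto; symmetry; apply segment_point_half).
  rewrite (segment_integral_swap D f ((a + b) / 2) ((c + a) / 2)) by auto.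
  rewrite (segment_integral_swap D f ((b + c) / 2) ((a + b) / 2)) by auto.
  rewrite (segment_integral_swap D f ((c + a) / 2) ((b + c) / 2)) by auto.
  ring.
Qed.

Lemma large_subtriangle (D : C -> Prop) (f : C -> C) (T : triangle) :
  convex D -> cont_on_set D f -> in_set D T ->
  exists S, In S (subtriangles T) /\
    Cmod (triangle_integral f T) / 4 <= Cmod (triangle_integral f S).
Proof.
  intros HD Hf HT; apply NNPP; intros H.
  assert (H' : forall S, In S (subtriangles T) ->
    Cmod (triangle_integral f S) < Cmod (triangle_integral f T) / 4).
  { intros S HS; apply Rnot_le_lt; intros HS'; apply H; exists S; auto. }
  assert (E := triangle_integral_subdivide D f T HD Hf HT).
  destruct T as [[a b] c]; cbn [subtriangles fold_right] in *.
  match type of E with _ = (?x + (?y + (?z + (?w + _))))%C =>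
    assert (Hx : Cmod x < Cmod (triangle_integral f (a, b, c)) / 4) by (apply H'; simpl; auto);
    assert (Hy : Cmod y < Cmod (triangle_integral f (a, b, c)) / 4) by (apply H'; simpl; auto);
    assert (Hz : Cmod z < Cmod (triangle_integral f (a, b, c)) / 4) by (apply H'; simpl; auto);
    assert (Hw : Cmod w < Cmod (triangle_integral f (a, b, c)) / 4) by (apply H'; simpl; auto);
    generalize dependent x; generalize dependent y; generalize dependent z;
    generalize dependent w
  end.
  generalize (triangle_integral f (a, b, c)); clear.
  intros i w Hw z Hz y Hy x -> Hx.
  assert (H1 := Cmod_triangle x (y + (z + (w + 0)))).
  assert (H2 := Cmod_triangle y (z + (w + 0))).
  assert (H3 := Cmod_triangle z (w + 0)).
  assert (H4 := Cmod_triangle w 0); rewrite Cmod_0 in H4; lra.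
Qed.

Lemma triangle_integral_minus (D : C -> Prop) (f g : C -> C) (T : triangle) :
  convex D -> cont_on_set D f -> cont_on_set D g -> in_set D T ->
  triangle_integral (fun w => f w - g w)%C T =
  (triangle_integral f T - triangle_integral g T)%C.
Proof.
  destruct T as [[a b] c]; intros HD Hf Hg [Ha [Hb Hc]]; simpl.
  rewrite !(segment_integral_minus D) by auto; ring.
Qed.

(** The integrand has the primitive [a * w + l * w^2], and the increments around the triangle
    cancel. The slope is written [2 * l] to match that primitive. *)
Lemma triangle_integral_affine (a l : C) (T : triangle) :
  triangle_integral (fun w => a + 2 * l * w)%C T = 0.
Proof.
  destruct T as [[x y] z]; simpl.
  assert (H : forall z, True -> C_diff (fun w => a * w + l * (w * w))%C z (a + 2 * l * z)%C)
    by (intros; apply C_diff_quadratic).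
  assert (Hc : cont_on_set (fun _ => True) (fun w => a + 2 * l * w)%C).
  { intros w _; apply C_diff_cont with (2 * l + 2 * 0 * w)%C.
    intros eps Heps; exists 1; split; [lra|]; intros v _.
    replace (a + 2 * l * v - (a + 2 * l * w) - (2 * l + 2 * 0 * w) * (v - w))%C
      with (RtoC 0) by ring.
    rewrite Cmod_0; apply Rmult_le_pos; [lra|apply Cmod_ge_0]. }
  rewrite !(segment_integral_derive (fun _ => True) (fun w => a * w + l * (w * w))%C)
    by (auto; intros ? ? ? ? ? ?; exact I).
  ring.
Qed.

Lemma segment_point_dist (a b c : C) (t : R) : 0 <= t <= 1 ->
  Cmod (segment_point a b t - c) <= Cmod (a - c) + Cmod (b - a).
Proof.
  intros Ht; unfold segment_point.
  replace (a + t * (b - a) - c)%C with ((a - c) + t * (b - a))%C by ring.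
  eapply Rle_trans; [apply Cmod_triangle|].
  rewrite (Cmod_mult t), Cmod_R, Rabs_pos_eq by lra.
  assert (H := Cmod_ge_0 (b - a)); nra.
Qed.

Lemma triangle_integral_bound (D : C -> Prop) (f : C -> C) (T : triangle) (M : R) :
  convex D -> cont_on_set D f -> in_set D T ->
  (forall w, D w -> Cmod (w - corner T) <= perimeter T -> Cmod (f w) <= M) ->
  Cmod (triangle_integral f T) <= perimeter T * M.
Proof.
  destruct T as [[a b] c]; intros HD Hf [Ha [Hb Hc]] HM; cbn in HM |- *.
  assert (Hab := Cmod_ge_0 (b - a)); assert (Hbc := Cmod_ge_0 (c - b));
    assert (Hca := Cmod_ge_0 (a - c)).
  assert (H1 : Cmod (segment_integral f a b) <= Cmod (b - a) * M).
  { apply segment_integral_bound with D; auto; intros t Ht; apply HM; [apply HD; auto|].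
    eapply Rle_trans; [apply segment_point_dist; auto|].
    replace (a - a)%C with (RtoC 0) by ring; rewrite Cmod_0; lra. }
  assert (H2 : Cmod (segment_integral f b c) <= Cmod (c - b) * M).
  { apply segment_integral_bound with D; auto; intros t Ht; apply HM; [apply HD; auto|].
    eapply Rle_trans; [apply segment_point_dist; auto|]; lra. }
  assert (H3 : Cmod (segment_integral f c a) <= Cmod (a - c) * M).
  { apply segment_integral_bound with D; auto; intros t Ht; apply HM; [apply HD; auto|].
    eapply Rle_trans; [apply segment_point_dist; auto|].
    rewrite (Cmod_sym c a); assert (H := Cmod_minus_triangle a b c).
    rewrite (Cmod_sym a b), (Cmod_sym b c) in H; lra. }
  eapply Rle_trans; [apply Cmod_triangle|].
  assert (H4 := Cmod_triangle (segment_integral f a b) (segment_integral f b c)); lra.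
Qed.

(** * Sequences of complex numbers, and the limit point of nested triangles *)

Definition C_seq_lim (u : nat -> C) (l : C) : Prop :=
  forall eps, 0 < eps -> exists N, forall n, (N <= n)%nat -> Cmod (u n - l) <= eps.

Definition C_seq_cauchy (u : nat -> C) : Prop :=
  forall eps, 0 < eps -> exists N, forall m n, (N <= m)%nat -> (N <= n)%nat ->
    Cmod (u m - u n) <= eps.

Lemma C_seq_complete (u : nat -> C) : C_seq_cauchy u -> exists l, C_seq_lim u l.
Proof.
  intros Hu.
  assert (Hpart : forall part : C -> R, (forall z w, part (z - w)%C = part z - part w) ->
    (forall z, Rabs (part z) <= Cmod z) -> exists l, Un_cv (fun n => part (u n)) l).
  { intros part Hsub Hle.
    destruct (Rcomplete.R_complete (fun n => part (u n))) as [l Hl]; [|exists l; auto].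
    intros eps Heps; destruct (Hu (eps / 2)) as [N HN]; [lra|].
    exists N; intros n m Hn Hm; unfold Rdist; rewrite <- Hsub.
    eapply Rle_lt_trans; [apply Hle|]; specialize (HN n m Hn Hm); lra. }
  assert (Hfst : forall z, Rabs (fst z) <= Cmod z)
    by (intros z; eapply Rle_trans; [apply Rmax_l|apply Rmax_Cmod]).
  assert (Hsnd : forall z, Rabs (snd z) <= Cmod z)
    by (intros z; eapply Rle_trans; [apply Rmax_r|apply Rmax_Cmod]).
  destruct (Hpart fst) as [x Hx]; auto.
  destruct (Hpart snd) as [y Hy]; auto.
  exists (x, y); intros eps Heps.
  assert (Hs : 0 < sqrt 2) by (apply sqrt_lt_R0; lra).
  assert (Hd : 0 < eps / sqrt 2) by (apply Rdiv_lt_0_compat; lra).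
  destruct (Hx _ Hd) as [N1 H1]; destruct (Hy _ Hd) as [N2 H2].
  exists (max N1 N2); intros n Hn.
  eapply Rle_trans; [apply Cmod_2Rmax|].
  replace eps with (sqrt 2 * (eps / sqrt 2)) by (field; lra).
  apply Rmult_le_compat_l; [lra|]; apply Rmax_lub; left.
  - apply (H1 n); lia.
  - apply (H2 n); lia.
Qed.

(** The metric form of [closure]; closedness of a set is expressed as [adherent D z -> D z]. *)
Definition adherent (D : C -> Prop) (z : C) : Prop :=
  forall eps, 0 < eps -> exists w, D w /\ Cmod (w - z) <= eps.

(** At each subdivision the integral loses at most a factor 4 while the perimeter halves. Near the
    common limit point [f] differs from an affine function by [eps] times the distance, so the
    integral over the [n]-th triangle is of order [eps / 4^n]. Convexity keeps the triangles in [D],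
    closedness the limit point. *)
Theorem goursat (D : C -> Prop) (f : C -> C) (T : triangle) :
  convex D -> (forall z, adherent D z -> D z) ->
  (forall z, D z -> exists l, C_diff f z l) -> in_set D T ->
  triangle_integral f T = 0.
Proof.
  intros HD Hclosed Hf HT.
  assert (Hcont : cont_on_set D f).
  { intros z Hz; destruct (Hf z Hz) as [l Hl]; apply C_diff_cont with l; auto. }
  (* The condition on [T] sits under the existential, so that [choice] yields a step function
     defined on all triangles. *)
  assert (Hstep : forall T, exists S, in_set D T -> In S (subtriangles T) /\
    Cmod (triangle_integral f T) / 4 <= Cmod (triangle_integral f S)).
  { intros T'; destruct (classic (in_set D T')) as [H|H].
    - destruct (large_subtriangle D f T') as [S HS]; auto; exists S; auto.
    - exists T'; intros H'; contradiction. }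
  destruct (choice _ Hstep) as [step Hs]; clear Hstep.
  set (Tn := fun n => Nat.iter n step T).
  set (L := perimeter T).
  assert (HTn : forall n, in_set D (Tn n) /\ perimeter (Tn n) = L * (/ 2) ^ n /\
    Cmod (triangle_integral f T) <= 4 ^ n * Cmod (triangle_integral f (Tn n))).
  { induction n as [|n [H1 [H2 H3]]].
    - simpl; unfold L; repeat split; auto; lra.
    - destruct (Hs _ H1) as [H4 H5].
      destruct (subtriangles_geometry D (Tn n) (step (Tn n))) as [H6 [H7 H8]]; auto.
      simpl; change (Nat.iter n step T) with (Tn n).
      repeat split; auto; [rewrite H7, H2; field|].
      assert (0 < 4 ^ n) by (apply pow_lt; lra); nra. }
  assert (HL : 0 <= L).
  { unfold L; destruct T as [[a b] c]; simpl; repeat apply Rplus_le_le_0_compat;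
      apply Cmod_ge_0. }
  assert (Hhalf : forall n, 0 < (/ 2) ^ n) by (intros; apply pow_lt; lra).
  (* The right-hand side is the sum of the perimeters [L * (/ 2) ^ i] for [n <= i < n + k]. *)
  assert (Hmove : forall n k,
    Cmod (corner (Tn (n + k)%nat) - corner (Tn n)) <= 2 * L * ((/ 2) ^ n - (/ 2) ^ (n + k))).
  { intros n; induction k as [|k IH].
    - rewrite Nat.add_0_r.
      replace (corner (Tn n) - corner (Tn n))%C with (RtoC 0) by ring; rewrite Cmod_0; lra.
    - eapply Rle_trans; [apply (Cmod_minus_triangle _ (corner (Tn (n + k)%nat)))|].
      destruct (HTn (n + k)%nat) as [H1 [H2 _]].
      destruct (subtriangles_geometry D (Tn (n + k)%nat) (Tn (S (n + k)))) as [_ [_ H8]];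
        auto; [apply Hs; auto|].
      replace (n + S k)%nat with (S (n + k)) by lia; rewrite H2 in H8; simpl pow; lra. }
  destruct (C_seq_complete (fun n => corner (Tn n))) as [p Hp].
  { intros eps Heps.
    (* Two corners of index at least [N] are within [4 * L * (/ 2) ^ N] of each other; the added 1
       covers a degenerate triangle with [L = 0]. *)
    destruct (pow_lt_1_zero (/ 2)) with (y := eps / (4 * L + 1)) as [N HN].
    { rewrite Rabs_pos_eq; lra. }
    { apply Rdiv_lt_0_compat; lra. }
    specialize (HN N (Nat.le_refl N)); rewrite Rabs_pos_eq in HN by (left; auto).
    apply Rmult_lt_compat_r with (r := 4 * L + 1) in HN; [|lra].
    unfold Rdiv in HN; rewrite Rmult_assoc, Rinv_l, Rmult_1_r in HN by lra.
    exists N; intros m n Hm Hn.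
    assert (H : forall k, (N <= k)%nat ->
      Cmod (corner (Tn k) - corner (Tn N)) <= 2 * L * (/ 2) ^ N).
    { intros k Hk; replace k with (N + (k - N))%nat by lia.
      eapply Rle_trans; [apply Hmove|]; apply Rmult_le_compat_l; [lra|].
      assert (Hh := Hhalf (N + (k - N))%nat); lra. }
    eapply Rle_trans; [apply (Cmod_minus_triangle _ (corner (Tn N)))|].
    rewrite (Cmod_sym (corner (Tn N))).
    assert (Hm' := H m Hm); assert (Hn' := H n Hn); assert (HN0 := Hhalf N); nra. }
  assert (Hpn : forall n, Cmod (corner (Tn n) - p) <= 2 * L * (/ 2) ^ n).
  { intros n; apply le_epsilon; intros eps Heps.
    destruct (Hp eps Heps) as [N HN].
    eapply Rle_trans; [apply (Cmod_minus_triangle _ (corner (Tn (n + N)%nat)))|].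
    rewrite (Cmod_sym (corner (Tn n))).
    apply Rplus_le_compat; [|apply HN; lia].
    eapply Rle_trans; [apply Hmove|]; apply Rmult_le_compat_l; [lra|].
    assert (Hh := Hhalf (n + N)%nat); lra. }
  assert (Dp : D p).
  { apply Hclosed; intros eps Heps; destruct (Hp eps Heps) as [N HN].
    exists (corner (Tn N)); split; [|auto].
    destruct (HTn N) as [H _]; revert H; destruct (Tn N) as [[a b] c]; simpl; tauto. }
  destruct (Hf p Dp) as [l Hl].
  apply Cmod_le_eps_0; intros eps Heps.
  (* Points within one perimeter of the [n]-th corner are within [3 * L * (/ 2) ^ n] of [p], since
     the corner itself is within twice the perimeter of [p]. Multiplied by the perimeter and by
     [4 ^ n], this leaves [3 * (L * L)]. *)
  destruct (Hl (eps / (3 * (L * L) + 1))) as [d [Hd Hdiff]].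
  { apply Rdiv_lt_0_compat; nra. }
  destruct (pow_lt_1_zero (/ 2)) with (y := d / (3 * L + 1)) as [n Hn].
  { rewrite Rabs_pos_eq; lra. }
  { apply Rdiv_lt_0_compat; lra. }
  specialize (Hn n (Nat.le_refl n)); rewrite Rabs_pos_eq in Hn by (left; auto).
  apply Rmult_lt_compat_r with (r := 3 * L + 1) in Hn; [|lra].
  unfold Rdiv in Hn; rewrite Rmult_assoc, Rinv_l, Rmult_1_r in Hn by lra.
  destruct (HTn n) as [H1 [H2 H3]].
  eapply Rle_trans; [apply H3|].
  (* The first-order Taylor polynomial of [f] at [p], whose integral over the triangle vanishes. *)
  set (g := fun w => ((f p - l * p) + 2 * (l / 2) * w)%C).
  assert (Hg : cont_on_set D g).
  { intros w _; apply C_diff_cont with l.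
    intros e He; exists 1; split; [lra|]; intros v _; unfold g.
    replace (f p - l * p + 2 * (l / 2) * v - (f p - l * p + 2 * (l / 2) * w) - l * (v - w))%C
      with (RtoC 0) by (field; exact RtoC_2_neq_0).
    rewrite Cmod_0; apply Rmult_le_pos; [lra|apply Cmod_ge_0]. }
  assert (E : triangle_integral f (Tn n) = triangle_integral (fun w => f w - g w)%C (Tn n)).
  { rewrite (triangle_integral_minus D) by auto; unfold g at 1.
    rewrite triangle_integral_affine; ring. }
  assert (Hb : Cmod (triangle_integral f (Tn n)) <=
    perimeter (Tn n) * (eps / (3 * (L * L) + 1) * (3 * L * (/ 2) ^ n))).
  { rewrite E; apply triangle_integral_bound with D; auto.
    - intros z Hz eps' Heps'.
      destruct (Hf z Hz) as [l' Hl'].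
      apply (C_diff_cont (fun w => f w - g w)%C z (l' - l)%C); auto.
      apply C_diff_minus; auto; intros e He; exists 1; split; [lra|]; intros v _; unfold g.
      replace (f p - l * p + 2 * (l / 2) * v - (f p - l * p + 2 * (l / 2) * z) - l * (v - z))%C
        with (RtoC 0) by (field; exact RtoC_2_neq_0).
      rewrite Cmod_0; apply Rmult_le_pos; [lra|apply Cmod_ge_0].
    - intros w Hw Hwn.
      assert (Hwp : Cmod (w - p) <= 3 * L * (/ 2) ^ n).
      { eapply Rle_trans; [apply (Cmod_minus_triangle _ (corner (Tn n)))|].
        specialize (Hpn n); rewrite H2 in Hwn; lra. }
      replace (f w - g w)%C with (f w - f p - l * (w - p))%C
        by (unfold g; field; exact RtoC_2_neq_0).
      eapply Rle_trans; [apply Hdiff|].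
      + assert (Hh := Hhalf n); nra.
      + apply Rmult_le_compat_l; auto; left; apply Rdiv_lt_0_compat; nra. }
  rewrite H2 in Hb.
  apply Rle_trans with (4 ^ n * (L * (/ 2) ^ n * (eps / (3 * (L * L) + 1) * (3 * L * (/ 2) ^ n)))).
  { apply Rmult_le_compat_l; auto; apply pow_le; lra. }
  assert (E4 : 4 ^ n * ((/ 2) ^ n * (/ 2) ^ n) = 1).
  { rewrite <- !Rpow_mult_distr; replace (4 * (/ 2 * / 2)) with 1 by field; apply pow1. }
  replace (4 ^ n * (L * (/ 2) ^ n * (eps / (3 * (L * L) + 1) * (3 * L * (/ 2) ^ n))))
    with ((4 ^ n * ((/ 2) ^ n * (/ 2) ^ n)) * (eps * (3 * (L * L)) / (3 * (L * L) + 1)))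
    by (field; nra).
  rewrite E4; apply (Rmult_le_reg_r (3 * (L * L) + 1)); [nra|].
  field_simplify; nra.
Qed.

(** * Primitives on discs *)

(** Compactness of a square containing [K] is applied to a gauge defined on the whole plane. At a
    point outside [K] the gauge is so small that its disc misses [K]; hence the centre found for a
    point of [K] is itself in [K]. *)
Lemma lebesgue_number (K : C -> Prop) (B : R) (Q : C -> R -> Prop) :
  (forall z, adherent K z -> K z) -> (forall z, K z -> Cmod z <= B) ->
  (forall z, K z -> exists r, 0 < r /\ Q z r) ->
  exists d, 0 < d /\ forall x, K x -> exists u r, K u /\ Q u r /\ Cmod (x - u) < r /\ d <= r.
Proof.
  intros Hclosed Hbound HQ.
  assert (Hdelta : forall z : C, exists d : posreal,
    (K z /\ Q z (2 * d)) \/ forall w, K w -> 2 * d < Cmod (w - z)).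
  { intros z; destruct (classic (K z)) as [Hz|Hz].
    - destruct (HQ z Hz) as [r [Hr Hr']].
      assert (Hr2 : 0 < r / 2) by lra.
      exists (mkposreal _ Hr2); left; split; auto; simpl.
      replace (2 * (r / 2)) with r by field; auto.
    - apply NNPP; intros H; apply Hz, Hclosed; intros eps Heps; apply NNPP; intros H'.
      assert (He : 0 < eps / 2) by lra.
      apply H; exists (mkposreal _ He); right; intros w Hw; simpl.
      apply Rnot_le_lt; intros Hle; apply H'; exists w; split; auto; lra. }
  destruct (choice _ Hdelta) as [delta Hd]; clear Hdelta.
  destruct (compactness_value_2d (- B) B (- B) B (fun u v => delta (u, v))) as [d Hdv].
  exists d; split; [apply cond_pos|]; intros x Kx.
  assert (Hx : -B <= fst x <= B /\ -B <= snd x <= B).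
  { assert (H := Rle_trans _ _ _ (Rmax_Cmod x) (Hbound x Kx)).
    assert (H1 := Rle_trans _ _ _ (Rmax_l _ _) H).
    assert (H2 := Rle_trans _ _ _ (Rmax_r _ _) H).
    split; apply Rabs_le_between; auto. }
  destruct (NNPP _ (Hdv (fst x) (snd x) (proj1 Hx) (proj2 Hx)))
    as [u [v [_ [_ [Hu [Hv Hle]]]]]].
  (* Coordinates within [delta] give a distance of at most [sqrt 2 * delta], which the doubled gauge
     absorbs. *)
  assert (Hxu : Cmod (x - (u, v)) < 2 * delta (u, v)).
  { eapply Rle_lt_trans; [apply Cmod_2Rmax|].
    assert (Hm : Rmax (Rabs (fst (x - (u, v))%C)) (Rabs (snd (x - (u, v))%C)) < delta (u, v))
      by (apply Rmax_lub_lt; auto).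
    assert (Hm0 : 0 <= Rmax (Rabs (fst (x - (u, v))%C)) (Rabs (snd (x - (u, v))%C)))
      by (eapply Rle_trans; [apply Rabs_pos|apply Rmax_l]).
    assert (Hs : sqrt 2 < 2) by (rewrite <- (sqrt_pow2 2) at 2 by lra; apply sqrt_lt_1; lra).
    assert (Hs0 := sqrt_pos 2); nra. }
  destruct (Hd (u, v)) as [[H1 H2]|H].
  - exists (u, v), (2 * delta (u, v)); repeat split; auto.
    assert (H0 := cond_pos (delta (u, v))); lra.
  - specialize (H x Kx); lra.
Qed.

Definition Cdisc (c : C) (r : R) (z : C) : Prop := Cmod (z - c) <= r.

Lemma disc_convex (c : C) (r : R) : convex (Cdisc c r).
Proof.
  intros a b t Ha Hb Ht; unfold Cdisc, segment_point in *.
  replace (a + t * (b - a) - c)%C with ((1 - t)%R * (a - c) + t * (b - c))%C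
    by (rewrite RtoC_minus; ring).
  eapply Rle_trans; [apply Cmod_triangle|]; rewrite !Cmod_mult, !Cmod_R, !Rabs_pos_eq by lra.
  nra.
Qed.

Lemma disc_closed (c : C) (r : R) (z : C) : adherent (Cdisc c r) z -> Cdisc c r z.
Proof.
  intros H; apply le_epsilon; intros eps Heps; destruct (H eps Heps) as [w [Hw Hz]].
  unfold Cdisc in Hw; rewrite Cmod_sym in Hz.
  assert (Ht := Cmod_minus_triangle z w c); lra.
Qed.

Lemma disc_bounded (c : C) (r : R) (z : C) : Cdisc c r z -> Cmod z <= Cmod c + r.
Proof.
  unfold Cdisc; intros H; replace z with (c + (z - c))%C by ring.
  eapply Rle_trans; [apply Cmod_triangle|]; lra.
Qed.

Lemma disc_center (c : C) (r : R) : 0 <= r -> Cdisc c r c.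
Proof. intros H; unfold Cdisc; replace (c - c)%C with (RtoC 0) by ring; rewrite Cmod_0; auto. Qed.

Lemma disc_subset (c c' : C) (r r' : R) (z : C) :
  Cdisc c' r' z -> Cmod (c' - c) + r' <= r -> Cdisc c r z.
Proof. unfold Cdisc; intros H H'; assert (Ht := Cmod_minus_triangle z c' c); lra. Qed.

Definition unif_cont (D : C -> Prop) (f : C -> C) : Prop :=
  forall eps, 0 < eps -> exists d, 0 < d /\
    forall x y, D x -> D y -> Cmod (y - x) < d -> Cmod (f y - f x) <= eps.

Lemma heine_disc (c : C) (r : R) (f : C -> C) :
  cont_on_set (Cdisc c r) f -> unif_cont (Cdisc c r) f.
Proof.
  intros Hf eps Heps.
  (* The doubled radius lets one centre control both [x] and every point within [d <= s] of it. *)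
  destruct (lebesgue_number (Cdisc c r) (Cmod c + r) (fun z s =>
    forall w, Cmod (w - z) < 2 * s -> Cmod (f w - f z) <= eps / 2)) as [d [Hd H]].
  - apply disc_closed.
  - apply disc_bounded.
  - intros z Hz; destruct (Hf z Hz (eps / 2)) as [d [Hd H]]; [lra|].
    exists (d / 2); split; [lra|]; intros w Hw; apply H; lra.
  - exists d; split; auto; intros x y Hx Hy Hxy.
    destruct (H x Hx) as [u [s [Hu [HQ [Hxu Hds]]]]].
    assert (Hyu := Cmod_minus_triangle y x u).
    assert (H1 := HQ x ltac:(lra)); assert (H2 := HQ y ltac:(lra)).
    eapply Rle_trans; [apply (Cmod_minus_triangle _ (f u))|].
    rewrite (Cmod_sym (f u)); lra.
Qed.

(** The remainder is the integral of [f - f x] over the segment from [x] to [y], so uniform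
    continuity of [f] makes the differentiability of [F] uniform. *)
Lemma unif_diff (c : C) (r : R) (F f : C -> C) :
  cont_on_set (Cdisc c r) f -> (forall z, Cdisc c r z -> C_diff F z (f z)) ->
  forall eps, 0 < eps -> exists d, 0 < d /\
    forall x y, Cdisc c r x -> Cdisc c r y -> Cmod (y - x) < d ->
    Cmod (F y - F x - f x * (y - x)) <= eps * Cmod (y - x).
Proof.
  intros Hf HF eps Heps; destruct (heine_disc c r f Hf eps Heps) as [d [Hd H]].
  exists d; split; auto; intros x y Hx Hy Hxy.
  assert (Hc : cont_on_set (Cdisc c r) (fun _ => f x)).
  { intros z _ e He; exists 1; split; [lra|]; intros w _.
    replace (f x - f x)%C with (RtoC 0) by ring; rewrite Cmod_0; lra. }
  replace (F y - F x - f x * (y - x))%C with (segment_integral (fun w => f w - f x)%C x y).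
  - rewrite (Rmult_comm eps).
    apply segment_integral_bound with (Cdisc c r); auto; [apply disc_convex| |].
    + intros z Hz e He; destruct (Hf z Hz e He) as [d' [Hd' H']].
      exists d'; split; auto; intros w Hw.
      replace (f w - f x - (f z - f x))%C with (f w - f z)%C by ring; auto.
    + intros t Ht; apply H; auto; [apply disc_convex; auto|].
      unfold segment_point; replace (x + t * (y - x) - x)%C with (t * (y - x))%C by ring.
      rewrite Cmod_mult, Cmod_R, Rabs_pos_eq by lra.
      assert (H0 := Cmod_ge_0 (y - x)); nra.
  - rewrite (segment_integral_minus (Cdisc c r)); auto; [|apply disc_convex].
    rewrite (segment_integral_derive (Cdisc c r) F) by (auto; apply disc_convex).
    unfold segment_integral at 1; rewrite CInt_const, Rminus_0_r; ring.
Qed.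

(** The primitive is the integral over the segment from the centre. Goursat's lemma for the triangle
    [(c, z, w)] turns its increment into the integral of [f] over the segment from [z] to [w]. *)
Lemma primitive_on_disc (c : C) (r : R) (f : C -> C) : 0 <= r ->
  (forall z, Cdisc c r z -> exists l, C_diff f z l) ->
  exists F, forall z, Cmod (z - c) < r -> C_diff F z (f z).
Proof.
  intros Hr Hf; exists (segment_integral f c); intros z Hz eps Heps.
  assert (Hcont : cont_on_set (Cdisc c r) f).
  { intros w Hw; destruct (Hf w Hw) as [l Hl]; apply C_diff_cont with l; auto. }
  assert (Hz' : Cdisc c r z) by (unfold Cdisc; lra).
  destruct (Hcont z Hz' eps Heps) as [d [Hd H]].
  exists (Rmin d (r - Cmod (z - c))); split; [apply Rmin_pos; lra|]; intros w Hw.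
  assert (H1 := Rlt_le_trans _ _ _ Hw (Rmin_l _ _)).
  assert (H2 := Rlt_le_trans _ _ _ Hw (Rmin_r _ _)).
  assert (Hw' : Cdisc c r w)
    by (unfold Cdisc; assert (Ht := Cmod_minus_triangle w z c); lra).
  assert (Hc := disc_center c r Hr).
  assert (E := goursat (Cdisc c r) f (c, z, w) (disc_convex c r) (disc_closed c r) Hf
    (conj Hc (conj Hz' Hw'))); simpl in E.
  rewrite (segment_integral_swap (Cdisc c r) f c w) in E by (auto; apply disc_convex).
  replace (segment_integral f c w - segment_integral f c z - f z * (w - z))%C
    with (segment_integral (fun v => f v - f z)%C z w).
  - rewrite Rmult_comm.
    apply segment_integral_bound with (Cdisc c r); auto; [apply disc_convex| |].
    + intros v Hv e He; destruct (Hcont v Hv e He) as [d' [Hd' H']].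
      exists d'; split; auto; intros x Hx.
      replace (f x - f z - (f v - f z))%C with (f x - f v)%C by ring; auto.
    + intros t Ht; apply H.
      unfold segment_point; replace (z + t * (w - z) - z)%C with (t * (w - z))%C by ring.
      rewrite Cmod_mult, Cmod_R, Rabs_pos_eq by lra.
      assert (H0 := Cmod_ge_0 (w - z)); nra.
  - rewrite (segment_integral_minus (Cdisc c r)); auto; [|apply disc_convex|].
    + unfold segment_integral at 2; rewrite CInt_const, Rminus_0_r.
      replace (segment_integral f z w) with (segment_integral f c w - segment_integral f c z)%C;
        [ring|].
      replace (segment_integral f c w) with (segment_integral f c w +
        (segment_integral f c z + segment_integral f z w + - segment_integral f c w))%C
        by (rewrite E; ring); ring.
    + intros v _ e He; exists 1; split; [lra|]; intros x _.
      replace (f z - f z)%C with (RtoC 0) by ring; rewrite Cmod_0; lra.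
Qed.

(** * The unit circle *)

Definition cis (t : R) : C := (cos t, sin t).

Lemma curve_diff_pair (x y : R -> R) (t dx dy : R) :
  is_derive x t dx -> is_derive y t dy -> curve_diff (fun s => (x s, y s)) t (dx, dy).
Proof.
  intros Hx Hy eps Heps.
  assert (He : 0 < eps / 2) by lra.
  apply is_derive_Reals in Hx; apply is_derive_Reals in Hy.
  destruct (Hx (eps / 2) He) as [d1 H1]; destruct (Hy (eps / 2) He) as [d2 H2].
  exists (Rmin d1 d2); split; [apply Rmin_pos; apply cond_pos|]; intros s Hs.
  assert (Hpart : forall f l d, (forall h, h <> 0 -> Rabs h < d ->
    Rabs ((f (t + h) - f t) / h - l) < eps / 2) -> Rabs (s - t) < d ->
    Rabs (f s - f t - (s - t) * l) <= eps / 2 * Rabs (s - t)).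
  { intros f l d H Hd; destruct (Req_dec s t) as [->|Hst].
    - unfold Rminus; rewrite !Rplus_opp_r, Rmult_0_l, Ropp_0, Rplus_0_r, Rabs_R0; lra.
    - specialize (H (s - t) ltac:(lra) Hd); replace (t + (s - t)) with s in H by ring.
      replace (f s - f t - (s - t) * l) with (((f s - f t) / (s - t) - l) * (s - t))
        by (field; lra).
      rewrite Rabs_mult; apply Rmult_le_compat_r; [apply Rabs_pos|lra]. }
  assert (A1 := Hpart x dx d1 H1 (Rlt_le_trans _ _ _ Hs (Rmin_l _ _))).
  assert (A2 := Hpart y dy d2 H2 (Rlt_le_trans _ _ _ Hs (Rmin_r _ _))).
  assert (Hs2 : sqrt 2 <= 2) by (rewrite <- (sqrt_pow2 2) at 2 by lra; apply sqrt_le_1; lra).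
  eapply Rle_trans; [apply Cmod_2Rmax|]; simpl.
  replace (x s + - x t + - ((s - t) * dx - 0 * dy)) with (x s - x t - (s - t) * dx) by ring.
  replace (y s + - y t + - ((s - t) * dy + 0 * dx)) with (y s - y t - (s - t) * dy) by ring.
  assert (A3 := Rmax_lub _ _ _ A1 A2).
  assert (A4 : 0 <= Rmax (Rabs (x s - x t - (s - t) * dx)) (Rabs (y s - y t - (s - t) * dy)))
    by (eapply Rle_trans; [apply Rabs_pos|apply Rmax_l]).
  assert (A5 := sqrt_pos 2); assert (A6 := Rabs_pos (s - t)); nra.
Qed.

Lemma cis_diff (t : R) : curve_diff cis t (Ci * cis t).
Proof.
  replace (Ci * cis t)%C with ((- sin t, cos t) : C).
  - apply curve_diff_pair; [apply is_derive_cos|apply is_derive_sin].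
  - unfold cis, Ci, Cmult; simpl; f_equal; ring.
Qed.

Lemma cis_cont (t : R) : curve_cont cis t.
Proof. apply curve_diff_cont with (Ci * cis t)%C, cis_diff. Qed.

Lemma cis_opp_diff (t : R) : curve_diff (fun s => cis (- s)) t (- Ci * cis (- t)).
Proof.
  replace (- Ci * cis (- t))%C with ((- sin t, - cos t) : C).
  - replace (fun s => cis (- s)) with (fun s => (cos s, - sin s)).
    + apply curve_diff_pair; [apply is_derive_cos|].
      apply (is_derive_opp (V := R_NormedModule)), is_derive_sin.
    + apply functional_extensionality; intros s; unfold cis; rewrite cos_neg, sin_neg; auto.
  - unfold cis, Ci, Cmult; simpl; rewrite cos_neg, sin_neg; f_equal; ring.
Qed.

Lemma cis_opp_cont (t : R) : curve_cont (fun s => cis (- s)) t.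
Proof. apply curve_diff_cont with (- Ci * cis (- t))%C, cis_opp_diff. Qed.

Lemma Cmod_cis (t : R) : Cmod (cis t) = 1.
Proof.
  unfold Cmod, cis; simpl; rewrite !Rmult_1_r, Rplus_comm.
  change (sqrt (Rsqr (sin t) + Rsqr (cos t)) = 1); rewrite sin2_cos2; apply sqrt_1.
Qed.

Lemma cis_mult_opp (t : R) : (cis t * cis (- t) = 1)%C.
Proof.
  unfold cis, Cmult; rewrite cos_neg, sin_neg; simpl; unfold RtoC.
  assert (H := sin2_cos2 t); unfold Rsqr in H; f_equal; lra.
Qed.

Lemma cis_0 : cis 0 = 1.
Proof. unfold cis, RtoC; rewrite cos_0, sin_0; auto. Qed.

Lemma cis_2PI : cis (2 * PI) = 1.
Proof. unfold cis, RtoC; rewrite cos_2PI, sin_2PI; auto. Qed.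

Lemma cis_opp_2PI : cis (- (2 * PI)) = 1.
Proof. unfold cis, RtoC; rewrite cos_neg, sin_neg, cos_2PI, sin_2PI; f_equal; ring. Qed.

Lemma two_PI_pos : 0 < 2 * PI.
Proof. assert (H := PI_RGT_0); lra. Qed.

Lemma Ci_neq_0 : Ci <> 0.
Proof. intros H; injection H; lra. Qed.

(** [k] is the constant that the chain rule produces in [t]: [i], [-i] or [s * i] in the uses
    below. *)
Lemma CInt_periodic_derive (g dg : R -> C) (k : C) : k <> 0 ->
  (forall t, curve_diff g t (k * dg t)) -> (forall t, curve_cont dg t) ->
  g (2 * PI) = g 0 -> CInt dg 0 (2 * PI) = 0.
Proof.
  intros Hk Hg Hdg Hper; assert (Hpi := two_PI_pos).
  assert (E : (k * CInt dg 0 (2 * PI) = 0)%C).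
  { rewrite <- CInt_scal by (lra || intros t _; auto).
    rewrite (CInt_derive g); [rewrite Hper; ring|lra|auto|].
    intros t _; apply curve_cont_mult; [apply curve_cont_const|auto]. }
  replace (CInt dg 0 (2 * PI)) with (/ k * (k * CInt dg 0 (2 * PI)))%C by (field; auto).
  rewrite E; ring.
Qed.

Lemma CInt_cis : CInt cis 0 (2 * PI) = 0.
Proof.
  apply (CInt_periodic_derive cis cis Ci).
  - apply Ci_neq_0.
  - apply cis_diff.
  - apply cis_cont.
  - rewrite cis_0, cis_2PI; auto.
Qed.

Lemma CInt_cis_opp : CInt (fun t => cis (- t)) 0 (2 * PI) = 0.
Proof.
  apply (CInt_periodic_derive (fun t => cis (- t)) (fun t => cis (- t)) (- Ci)).
  - intros H; apply Ci_neq_0; replace Ci with (- - Ci)%C by ring; rewrite H; ring.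
  - apply cis_opp_diff.
  - apply cis_opp_cont.
  - rewrite Ropp_0, cis_0, cis_opp_2PI; auto.
Qed.

(** * Cauchy's formula for the derivative *)

Lemma curve_cont_combine (p q : R -> C) (s : C) (t : R) :
  curve_cont p t -> curve_cont q t -> curve_cont (fun x => p x + s * q x)%C t.
Proof.
  intros Hp Hq; apply curve_cont_plus; auto; apply curve_cont_mult; auto.
  apply curve_cont_const.
Qed.

(** The argument [p t + s * q t] covers a circle that is scaled ([p] constant, [q = cis]) and one
    that is translated ([p = r * cis], [q = 1]). As [q] and the kernel [k] are bounded by 1, the
    uniform remainder of [unif_diff] passes to the integral. *)
Lemma diff_under_integral (c : C) (r a b : R) (H h : C -> C) (p q k : R -> C) (s0 : C) (eta : R) :
  a <= b -> 0 < eta ->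
  cont_on_set (Cdisc c r) h -> (forall w, Cdisc c r w -> C_diff H w (h w)) ->
  (forall t, curve_cont p t) -> (forall t, curve_cont q t) -> (forall t, curve_cont k t) ->
  (forall t, Cmod (q t) <= 1) -> (forall t, Cmod (k t) <= 1) ->
  (forall s t, Cmod (s - s0) < eta -> Cdisc c r (p t + s * q t)%C) ->
  C_diff (fun s => CInt (fun t => H (p t + s * q t) * k t)%C a b) s0
    (CInt (fun t => h (p t + s0 * q t) * (q t * k t))%C a b).
Proof.
  intros Hab Heta Hh HH Hp Hq Hk Hq1 Hk1 HD eps Heps.
  assert (He : 0 < eps / (b - a + 1)) by (apply Rdiv_lt_0_compat; lra).
  destruct (unif_diff c r H h Hh HH _ He) as [d [Hd Hu]].
  exists (Rmin d eta); split; [apply Rmin_pos; auto|]; intros s Hs.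
  assert (Hs1 := Rlt_le_trans _ _ _ Hs (Rmin_l _ _)).
  assert (Hs2 := Rlt_le_trans _ _ _ Hs (Rmin_r _ _)).
  assert (Hs0 : Cmod (s0 - s0) < eta)
    by (replace (s0 - s0)%C with (RtoC 0) by ring; rewrite Cmod_0; auto).
  assert (HcontH : forall s, Cmod (s - s0) < eta -> forall t,
    curve_cont (fun t => H (p t + s * q t) * k t)%C t).
  { intros s' Hs' t; apply curve_cont_mult; auto.
    apply (C_cont_comp_curve H (fun t => p t + s' * q t)%C).
    - apply C_diff_cont with (h (p t + s' * q t)%C); auto.
    - apply curve_cont_combine; auto. }
  assert (Hconth : forall t, curve_cont (fun t => h (p t + s0 * q t) * (q t * k t))%C t).
  { intros t; apply curve_cont_mult.
    - apply (C_cont_comp_curve h (fun t => p t + s0 * q t)%C); auto.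
      apply curve_cont_combine; auto.
    - apply curve_cont_mult; auto. }
  assert (Hcm : forall f g, (forall t, curve_cont f t) -> (forall t, curve_cont g t) ->
    forall t, curve_cont (fun t => f t - g t)%C t).
  { intros f g Hf Hg t.
    replace (fun t => f t - g t)%C with (fun t => f t + (-1) * g t)%C
      by (apply functional_extensionality; intros; ring).
    apply curve_cont_combine; auto. }
  rewrite (Cmult_comm _ (s - s0)).
  assert (Hscal : forall t, curve_cont
    (fun t => (s - s0) * (h (p t + s0 * q t) * (q t * k t)))%C t).
  { intros t; apply curve_cont_mult; auto; apply curve_cont_const. }
  assert (HcontD : forall t, curve_cont
    (fun t => H (p t + s * q t) * k t - H (p t + s0 * q t) * k t)%C t)
    by (apply Hcm; apply HcontH; auto).
  rewrite <- CInt_scal by (auto || intros t _; auto).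
  rewrite <- (CInt_minus (fun t => H (p t + s * q t) * k t)%C) by
    (auto || intros t _; apply HcontH; auto).
  rewrite <- CInt_minus by (auto || intros t _; auto).
  eapply Rle_trans; [apply CInt_bound with (M := eps / (b - a + 1) * Cmod (s - s0))|]; auto.
  - intros t _; apply Hcm; auto.
  - intros t _.
    replace (H (p t + s * q t) * k t - H (p t + s0 * q t) * k t -
        (s - s0) * (h (p t + s0 * q t) * (q t * k t)))%C
      with ((H (p t + s * q t) - H (p t + s0 * q t) -
        h (p t + s0 * q t) * ((p t + s * q t) - (p t + s0 * q t))) * k t)%C by ring.
    rewrite Cmod_mult.
    assert (E : Cmod (p t + s * q t - (p t + s0 * q t)) <= Cmod (s - s0)).
    { replace (p t + s * q t - (p t + s0 * q t))%C with ((s - s0) * q t)%C by ring.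
      rewrite Cmod_mult; assert (A := Cmod_ge_0 (s - s0)); specialize (Hq1 t); nra. }
    assert (U := Hu (p t + s0 * q t)%C (p t + s * q t)%C (HD s0 t Hs0) (HD s t Hs2) ltac:(lra)).
    assert (A := Cmod_ge_0 (H (p t + s * q t) - H (p t + s0 * q t) -
        h (p t + s0 * q t) * ((p t + s * q t) - (p t + s0 * q t)))%C).
    specialize (Hk1 t); assert (Hk0 := Cmod_ge_0 (k t)); nra.
  - assert (A := Cmod_ge_0 (s - s0)).
    replace ((b - a) * (eps / (b - a + 1) * Cmod (s - s0)))
      with (((b - a) / (b - a + 1)) * (eps * Cmod (s - s0))) by (field; lra).
    rewrite <- (Rmult_1_l (eps * Cmod (s - s0))) at 2.
    apply Rmult_le_compat_r; [nra|].
    apply (Rmult_le_reg_r (b - a + 1)); [lra|]; field_simplify; lra.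
Qed.

Lemma constant_derivative (r : R) (g : C -> C) (l : C) : 0 <= r ->
  (forall s, Cdisc 0 r s -> C_diff g s l) -> (g r - g 0 = r * l)%C.
Proof.
  intros Hr Hg.
  rewrite <- (segment_integral_derive (Cdisc 0 r) g (fun _ => l)); auto.
  - unfold segment_integral; rewrite CInt_const, Rminus_0_r; ring.
  - apply disc_convex.
  - intros w _ e He; exists 1; split; [lra|]; intros x _.
    replace (l - l)%C with (RtoC 0) by ring; rewrite Cmod_0; lra.
  - apply disc_center; auto.
  - unfold Cdisc; replace (r - 0)%C with (RtoC r) by ring.
    rewrite Cmod_R, Rabs_pos_eq; lra.
Qed.

(** With [w = z + r e^{it}] this is [r / i] times the contour integral of [f(w) / (w - z)^2], which
    is why it computes [2 pi r f'(z)]. *)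
Definition circle_integral (f : C -> C) (r : R) (z : C) : C :=
  CInt (fun t => f (z + r * cis t) * cis (- t))%C 0 (2 * PI).

Lemma disc_circle (z : C) (r : R) (s : C) (t : R) : Cmod s <= r -> Cdisc z r (z + s * cis t)%C.
Proof.
  intros Hs; unfold Cdisc; replace (z + s * cis t - z)%C with (s * cis t)%C by ring.
  rewrite Cmod_mult, Cmod_cis; lra.
Qed.

(* Both [s |-> int h (z + s cis t) dt] and [s |-> int H (z + s cis t) cis (-t) dt] are
   differentiated in the complex parameter [s]; the first one is constant. *)
Lemma circle_integral_primitive (z : C) (r R : R) (H h k : C -> C) :
  0 <= r < R -> cont_on_set (Cdisc z R) k ->
  (forall w, Cdisc z R w -> C_diff H w (h w)) -> (forall w, Cdisc z R w -> C_diff h w (k w)) ->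
  circle_integral H r z = (2 * PI * r * h z)%C.
Proof.
  intros Hr Hk HH Hh.
  assert (Hpi := two_PI_pos).
  assert (Hhc : cont_on_set (Cdisc z R) h)
    by (intros w Hw; apply C_diff_cont with (k w); auto).
  assert (Hin : forall s t, Cmod s <= R -> Cdisc z R (z + s * cis t)%C)
    by (intros; apply disc_circle; auto).
  assert (Hnear : forall s0, Cdisc 0 r s0 ->
    forall s t, Cmod (s - s0) < R - r -> Cdisc z R (z + s * cis t)%C).
  { intros s0 Hs0 s t Hs; apply Hin; unfold Cdisc in Hs0.
    assert (Ht := Cmod_minus_triangle s s0 0).
    replace (s - 0)%C with s in Ht by ring; lra. }
  assert (Hcis1 : forall t, Cmod (cis t) <= 1) by (intros; rewrite Cmod_cis; lra).
  (* [2 PI] times the mean of [h] over the circle of radius [Cmod s]; the factor 1 is the kernel in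
     [diff_under_integral]. *)
  set (m := fun s => CInt (fun t => h (z + s * cis t) * 1)%C 0 (2 * PI)).
  assert (Hm' : forall s, Cdisc 0 r s -> C_diff m s 0).
  { intros s Hs.
    replace (RtoC 0) with (CInt (fun t => k (z + s * cis t) * (cis t * 1))%C 0 (2 * PI)).
    - apply (diff_under_integral z R 0 (2 * PI) h k (fun _ => z) cis (fun _ => RtoC 1) s (R - r));
        auto; try lra.
      + intros; apply curve_cont_const.
      + apply cis_cont.
      + intros; apply curve_cont_const.
      + intros; rewrite Cmod_1; lra.
      + apply Hnear; auto.
    - assert (Hs' : Cmod s <= r) by (unfold Cdisc in Hs; replace (s - 0)%C with s in Hs by ring; auto).
      (* For [s <> 0] the integrand is the [t]-derivative of [h (z + s * cis t)] divided by [s * i].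
         At [s = 0] this division is impossible, but the integrand is then a multiple of [cis]. *)
      destruct (classic (s = 0)) as [->|Hs0].
      + rewrite (CInt_ext _ (fun t => k z * cis t)%C).
        * rewrite CInt_scal by (lra || intros t _; apply cis_cont).
          rewrite CInt_cis; ring.
        * lra.
        * intros t _; replace (z + 0 * cis t)%C with z by ring; ring.
      + apply (CInt_periodic_derive (fun t => h (z + s * cis t)%C) _ (s * Ci)).
        * intros E; apply Hs0; replace s with ((s * Ci) * / Ci)%C by (field; apply Ci_neq_0).
          rewrite E; ring.
        * intros t; replace (s * Ci * (k (z + s * cis t) * (cis t * 1)))%C
            with (k (z + s * cis t) * (s * (Ci * cis t)))%C by ring.
          apply (C_diff_comp_curve h (fun t => z + s * cis t)%C).
          -- apply Hh, Hin; lra.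
          -- replace (fun t => (z + s * cis t)%C)
               with (fun t => (fun w => w * s + 0 * (w * w) + z)%C (cis t))
               by (apply functional_extensionality; intros; ring).
             apply (C_diff_comp_curve (fun w => w * s + 0 * (w * w) + z)%C);
               [|apply cis_diff].
             intros e He; exists 1; split; [lra|]; intros w _.
             match goal with |- Cmod ?x <= _ => replace x with (RtoC 0) by ring end.
             rewrite Cmod_0; apply Rmult_le_pos; [lra|apply Cmod_ge_0].
        * intros t; apply curve_cont_mult.
          -- apply (C_cont_comp_curve k (fun t => z + s * cis t)%C).
             ++ apply Hk, Hin; lra.
             ++ apply (curve_cont_combine (fun _ => z)); [apply curve_cont_const|apply cis_cont].
          -- apply curve_cont_mult; [apply cis_cont|apply curve_cont_const].
        * rewrite cis_0, cis_2PI; auto. }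
  assert (Hm : forall s, Cdisc 0 r s -> m s = (2 * PI * h z)%C).
  { intros s Hs.
    assert (E0 : m 0 = (2 * PI * h z)%C).
    { unfold m; rewrite (CInt_ext _ (fun _ => h z)).
      - rewrite CInt_const, Rminus_0_r, RtoC_mult; auto.
      - lra.
      - intros t _; replace (z + 0 * cis t)%C with z by ring; ring. }
    rewrite <- E0.
    assert (Ed : segment_integral (fun _ => RtoC 0) 0 s = (m s - m 0)%C).
    { apply (segment_integral_derive (Cdisc 0 r)); auto.
      - apply disc_convex.
      - intros w _ e He; exists 1; split; [lra|]; intros x _.
        replace (0 - 0)%C with (RtoC 0) by ring; rewrite Cmod_0; lra.
      - apply disc_center; lra. }
    unfold segment_integral in Ed; rewrite CInt_const in Ed.
    replace (m s) with (m 0 + (m s - m 0))%C by ring; rewrite <- Ed; ring. }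
  set (phi := fun s => CInt (fun t => H (z + s * cis t) * cis (- t))%C 0 (2 * PI)).
  (* Differentiation in [s] produces a factor [cis t] that cancels the kernel [cis (- t)], so the
     derivative of [phi] is the constant [m]. *)
  assert (Hphi : (phi r - phi 0 = r * (2 * PI * h z))%C).
  { apply constant_derivative; [lra|]; intros s Hs.
    rewrite <- (Hm s Hs); unfold m.
    rewrite (CInt_ext (fun t => h (z + s * cis t) * 1)%C
      (fun t => h (z + s * cis t) * (cis t * cis (- t)))%C)
      by (lra || intros; rewrite cis_mult_opp; auto).
    apply (diff_under_integral z R 0 (2 * PI) H h (fun _ => z) cis (fun t => cis (- t)) s (R - r));
      auto; try lra.
    - intros; apply curve_cont_const.
    - apply cis_cont.
    - apply cis_opp_cont.
    - apply Hnear; auto. }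
  assert (E0 : phi 0 = 0).
  { unfold phi; rewrite (CInt_ext _ (fun t => H z * cis (- t))%C).
    - rewrite CInt_scal by (lra || intros t _; apply cis_opp_cont).
      rewrite CInt_cis_opp; ring.
    - lra.
    - intros t _; replace (z + 0 * cis t)%C with z by ring; ring. }
  unfold circle_integral; fold (phi r); rewrite E0 in Hphi.
  replace (phi r) with (phi r - 0)%C by ring; rewrite Hphi; ring.
Qed.

(** The case of a moving centre; the strict inequality leaves room for the circles about points near
    [z] inside the disc of radius [R]. *)
Lemma circle_integral_diff (c : C) (r R : R) (F f : C -> C) (z : C) :
  0 < r -> Cmod (z - c) + r < R ->
  cont_on_set (Cdisc c R) f -> (forall w, Cdisc c R w -> C_diff F w (f w)) ->
  C_diff (circle_integral F r) z (circle_integral f r z).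
Proof.
  intros Hr HR Hf HF; unfold circle_integral.
  assert (Hpi := two_PI_pos).
  replace (fun z => CInt (fun t => F (z + r * cis t) * cis (- t))%C 0 (2 * PI))
    with (fun z => CInt (fun t => F (r * cis t + z * 1) * cis (- t))%C 0 (2 * PI)).
  - rewrite (CInt_ext _ (fun t => f (r * cis t + z * 1) * (1 * cis (- t)))%C).
    + apply (diff_under_integral c R 0 (2 * PI) F f (fun t => r * cis t)%C (fun _ => RtoC 1)
        (fun t => cis (- t)) z (R - (Cmod (z - c) + r))); auto; try lra.
      * intros t; apply curve_cont_mult; [apply curve_cont_const|apply cis_cont].
      * intros; apply curve_cont_const.
      * apply cis_opp_cont.
      * intros; rewrite Cmod_1; lra.
      * intros; rewrite Cmod_cis; lra.
      * intros s t Hs; unfold Cdisc.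
        replace (r * cis t + s * 1 - c)%C with (r * cis t + (s - c))%C by ring.
        eapply Rle_trans; [apply Cmod_triangle|].
        rewrite Cmod_mult, Cmod_cis, Cmod_R, Rabs_pos_eq by lra.
        assert (Ht := Cmod_minus_triangle s z c); lra.
    + lra.
    + intros t _; replace (r * cis t + z * 1)%C with (z + r * cis t)%C by ring; ring.
  - apply functional_extensionality; intros w; apply CInt_ext; [lra|]; intros t _.
    replace (r * cis t + w * 1)%C with (w + r * cis t)%C by ring; auto.
Qed.

Lemma C_diff_unique (f : C -> C) (z l l' : C) : C_diff f z l -> C_diff f z l' -> l = l'.
Proof. intros H H'; apply C_derive_eq in H; apply C_derive_eq in H'; congruence. Qed.

Lemma RtoC_neq_0 (x : R) : x <> 0 -> RtoC x <> 0.
Proof. intros H E; apply RtoC_inj in E; auto. Qed.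

(* The formula holds for the second primitive [G] of [f]; differentiating it twice under the
   integral sign transports it to [f], without presupposing that the derivative of [f] is
   continuous. *)
Theorem cauchy_derivative_formula (c : C) (r : R) (f : C -> C) (z : C) : 0 < r ->
  (forall w, Cdisc c (4 * r) w -> exists l, C_diff f w l) -> Cmod (z - c) < r ->
  C_diff f z (circle_integral f r z / (2 * PI * r)%R).
Proof.
  intros Hr Hf Hz.
  destruct (primitive_on_disc c (4 * r) f ltac:(lra) Hf) as [F HF].
  (* A primitive is obtained in the interior only, so the radius drops from [4 * r] through
     [7 / 2 * r] to [3 * r]. The last one contains the disc of radius [2 * r] about every point
     within [r] of [c]. *)
  destruct (primitive_on_disc c (7 / 2 * r) F) as [G HG]; [lra| |].
  { intros w Hw; exists (f w); apply HF; unfold Cdisc in Hw; lra. }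
  assert (HF3 : forall w, Cdisc c (3 * r) w -> C_diff F w (f w))
    by (intros w Hw; apply HF; unfold Cdisc in Hw; lra).
  assert (HG3 : forall w, Cdisc c (3 * r) w -> C_diff G w (F w))
    by (intros w Hw; apply HG; unfold Cdisc in Hw; lra).
  assert (Hfc : cont_on_set (Cdisc c (3 * r)) f).
  { intros w Hw; destruct (Hf w) as [l Hl]; [unfold Cdisc in *; lra|].
    apply C_diff_cont with l; auto. }
  assert (HFc : cont_on_set (Cdisc c (3 * r)) F)
    by (intros w Hw; apply C_diff_cont with (f w); auto).
  assert (Hk : RtoC (2 * PI * r) <> 0)
    by (apply RtoC_neq_0; assert (H := two_PI_pos); nra).
  assert (E1 : forall w, Cmod (w - c) < r -> circle_integral G r w = ((2 * PI * r)%R * F w)%C).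
  { intros w Hw; rewrite !RtoC_mult.
    assert (Hsub : forall v, Cdisc w (2 * r) v -> Cdisc c (3 * r) v)
      by (intros v Hv; apply disc_subset with w (2 * r); auto; lra).
    apply (circle_integral_primitive w r (2 * r) G F f); auto; try lra.
    intros v Hv; auto. }
  (* Both sides are derivatives of [circle_integral G r] at [w], one computed under the integral
     sign and the other from [E1]. *)
  assert (E2 : forall w, Cmod (w - c) < r -> circle_integral F r w = ((2 * PI * r)%R * f w)%C).
  { intros w Hw.
    apply (C_diff_unique (circle_integral G r) w).
    - apply (circle_integral_diff c r (3 * r)); auto; lra.
    - apply (C_diff_ext (fun v => (2 * PI * r)%R * F v)%C _ _ _ (r - Cmod (w - c))); [lra| |].
      + intros v Hv; symmetry; apply E1.
        assert (Ht := Cmod_minus_triangle v w c); lra.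
      + apply C_diff_scal, HF3; unfold Cdisc; lra. }
  apply (C_diff_ext (fun v => / (2 * PI * r)%R * circle_integral F r v)%C _ _ _
    (r - Cmod (z - c))); [lra| |].
  - intros v Hv; rewrite E2; [field; auto|].
    assert (Ht := Cmod_minus_triangle v z c); lra.
  - replace (circle_integral f r z / (2 * PI * r)%R)%C
      with (/ (2 * PI * r)%R * circle_integral f r z)%C by (field; auto).
    apply C_diff_scal, (circle_integral_diff c r (3 * r)); auto; lra.
Qed.

Lemma circle_integrand_cont (f : C -> C) (r : R) (z : C) : 0 <= r ->
  cont_on_set (Cdisc z r) f ->
  forall t, curve_cont (fun t => f (z + r * cis t) * cis (- t))%C t.
Proof.
  intros Hr Hf t; apply curve_cont_mult; [|apply cis_opp_cont].
  apply (C_cont_comp_curve f (fun t => z + r * cis t)%C).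
  - apply Hf, disc_circle; rewrite Cmod_R, Rabs_pos_eq; lra.
  - apply (curve_cont_combine (fun _ => z)); [apply curve_cont_const|apply cis_cont].
Qed.

(** The disc of radius [4 * r] is the one required by the formula; the size of [f] enters only
    through the circle of radius [r]. *)
Lemma cauchy_estimate (c : C) (r M : R) (f : C -> C) (l : C) : 0 < r ->
  (forall w, Cdisc c (4 * r) w -> exists l, C_diff f w l) ->
  (forall w, Cdisc c r w -> Cmod (f w) <= M) -> C_diff f c l -> Cmod l <= M / r.
Proof.
  intros Hr Hf HM Hl; assert (Hpi := two_PI_pos).
  assert (Hc : Cmod (c - c) < r)
    by (replace (c - c)%C with (RtoC 0) by ring; rewrite Cmod_0; auto).
  rewrite (C_diff_unique _ _ _ _ Hl (cauchy_derivative_formula c r f c Hr Hf Hc)).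
  assert (Hk : 0 < 2 * PI * r) by nra.
  rewrite Cmod_div by (apply RtoC_neq_0; lra).
  rewrite Cmod_R, Rabs_pos_eq by lra.
  assert (Hb : Cmod (circle_integral f r c) <= (2 * PI - 0) * M).
  { apply CInt_bound; [lra| |].
    - intros t _; apply circle_integrand_cont; [lra|].
      intros w Hw; destruct (Hf w) as [l' Hl']; [unfold Cdisc in *; lra|].
      apply C_diff_cont with l'; auto.
    - intros t _; rewrite Cmod_mult, Cmod_cis, Rmult_1_r; apply HM, disc_circle.
      rewrite Cmod_R, Rabs_pos_eq; lra. }
  apply (Rmult_le_reg_r (2 * PI * r)); auto.
  unfold Rdiv; rewrite Rmult_assoc, Rinv_l by lra.
  replace (M * / r * (2 * PI * r)) with ((2 * PI - 0) * M) by (field; lra); lra.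
Qed.

(** The formula writes [f'] as a weighted average of [f] over a translated circle, so uniform
    continuity of [f] passes to [f']. *)
Lemma derivative_cont (c : C) (r : R) (f f' : C -> C) : 0 < r ->
  (forall w, Cdisc c (4 * r) w -> C_diff f w (f' w)) -> C_cont f' c.
Proof.
  intros Hr Hf eps Heps; assert (Hpi := two_PI_pos).
  assert (Hfc : cont_on_set (Cdisc c (2 * r)) f).
  { intros w Hw; apply C_diff_cont with (f' w), Hf; unfold Cdisc in *; lra. }
  assert (He : 0 < eps * r) by nra.
  destruct (heine_disc c (2 * r) f Hfc (eps * r) He) as [d [Hd H]].
  exists (Rmin d r); split; [apply Rmin_pos; auto|]; intros w Hw.
  assert (Hw1 := Rlt_le_trans _ _ _ Hw (Rmin_l _ _)).
  assert (Hw2 := Rlt_le_trans _ _ _ Hw (Rmin_r _ _)).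
  assert (E : forall z, Cmod (z - c) < r ->
    f' z = (circle_integral f r z / (2 * PI * r)%R)%C).
  { intros z Hz; apply (C_diff_unique f z).
    - apply Hf; unfold Cdisc; lra.
    - apply cauchy_derivative_formula with c; auto; intros v Hv; exists (f' v); auto. }
  assert (Hc : Cmod (c - c) < r)
    by (replace (c - c)%C with (RtoC 0) by ring; rewrite Cmod_0; auto).
  rewrite (E w Hw2), (E c Hc).
  assert (Hk : 0 < 2 * PI * r) by nra.
  assert (Hk' : RtoC (2 * PI * r) <> 0) by (apply RtoC_neq_0; lra).
  replace (circle_integral f r w / (2 * PI * r)%R - circle_integral f r c / (2 * PI * r)%R)%C
    with ((circle_integral f r w - circle_integral f r c) / (2 * PI * r)%R)%C by (field; auto).
  rewrite Cmod_div by auto; rewrite Cmod_R, Rabs_pos_eq by lra.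
  assert (Hcont : forall z, Cmod (z - c) < r ->
    forall t, curve_cont (fun t => f (z + r * cis t) * cis (- t))%C t).
  { intros z Hz; apply circle_integrand_cont; [lra|]; intros v Hv; apply Hfc.
    apply disc_subset with z r; auto; lra. }
  assert (Hb : Cmod (circle_integral f r w - circle_integral f r c) <= (2 * PI - 0) * (eps * r)).
  { unfold circle_integral; rewrite <- CInt_minus by (lra || intros t _; auto).
    apply CInt_bound; [lra| |].
    - intros t _.
      replace (fun t => f (w + r * cis t) * cis (- t) - f (c + r * cis t) * cis (- t))%C
        with (fun t => f (w + r * cis t) * cis (- t) + (-1) * (f (c + r * cis t) * cis (- t)))%C
        by (apply functional_extensionality; intros; ring).
      apply curve_cont_combine; auto.
    - intros t _.
      replace (f (w + r * cis t) * cis (- t) - f (c + r * cis t) * cis (- t))%C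
        with ((f (w + r * cis t) - f (c + r * cis t)) * cis (- t))%C by ring.
      rewrite Cmod_mult, Cmod_cis, Rmult_1_r.
      assert (Hcirc : forall z, Cdisc z r (z + r * cis t)%C)
        by (intros; apply disc_circle; rewrite Cmod_R, Rabs_pos_eq; lra).
      apply H.
      + apply disc_subset with c r; auto; lra.
      + apply disc_subset with w r; auto; lra.
      + replace (w + r * cis t - (c + r * cis t))%C with (w - c)%C by ring; auto. }
  apply (Rmult_le_reg_r (2 * PI * r)); auto.
  unfold Rdiv; rewrite Rmult_assoc, Rinv_l by lra; lra.
Qed.

(** Once [f'] is known to be continuous, the formula expressing it through [f] can itself be
    differentiated under the integral sign. *)
Theorem derivative_differentiable (c : C) (r : R) (f f' : C -> C) : 0 < r ->
  (forall w, Cdisc c r w -> C_diff f w (f' w)) -> exists l, C_diff f' c l.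
Proof.
  intros Hr8 Hf8; set (r8 := r) in *; clearbody r8; clear r.
  (* Continuity of [f'] is needed on the disc of radius [4 * r], and at each of its points
     [derivative_cont] uses another disc of radius [4 * r]. *)
  set (r := r8 / 8); assert (E8 : r8 = 8 * r) by (unfold r; field).
  assert (Hr : 0 < r) by lra; clearbody r; subst r8.
  assert (Hf : forall w, Cdisc c (4 * r) w -> C_diff f w (f' w))
    by (intros w Hw; apply Hf8; unfold Cdisc in *; lra).
  assert (Hc' : cont_on_set (Cdisc c (4 * r)) f').
  { intros w Hw; apply (derivative_cont w r f f' Hr).
    intros v Hv; apply Hf8; apply disc_subset with w (4 * r); auto; unfold Cdisc in Hw; lra. }
  assert (Hk : RtoC (2 * PI * r) <> 0)
    by (apply RtoC_neq_0; assert (H := two_PI_pos); nra).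
  exists (/ (2 * PI * r)%R * circle_integral f' r c)%C.
  apply (C_diff_ext (fun v => / (2 * PI * r)%R * circle_integral f r v)%C _ _ _ r); auto.
  - intros w Hw; symmetry; rewrite (C_diff_unique f w (f' w)
      (circle_integral f r w / (2 * PI * r)%R)%C).
    + field; auto.
    + apply Hf; unfold Cdisc; lra.
    + apply cauchy_derivative_formula with c; auto; intros v Hv; exists (f' v); auto.
  - apply C_diff_scal, (circle_integral_diff c r (4 * r)); auto.
    replace (c - c)%C with (RtoC 0) by ring; rewrite Cmod_0; lra.
Qed.

(** * Holomorphic functions on open sets *)

Lemma open_disc_subset (Omega : C -> Prop) (z : C) : open Omega -> Omega z ->
  exists r, 0 < r /\ forall w, Cdisc z r w -> Omega w.
Proof.
  intros HO Hz; destruct (proj1 (C_open Omega) HO z Hz) as [d [Hd H]].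
  exists (d / 2); split; [lra|]; intros w Hw; apply H; unfold Cdisc in Hw; lra.
Qed.

Lemma holomorphic_C_diff (Omega : C -> Prop) (f : C -> C) (z : C) :
  holomorphic Omega f -> Omega z -> C_diff f z (C_derive f z).
Proof. intros Hf Hz; apply ex_derive_C_diff, Hf, Hz. Qed.

Lemma holomorphic_derive (Omega : C -> Prop) (f : C -> C) :
  open Omega -> holomorphic Omega f -> holomorphic Omega (C_derive f).
Proof.
  intros HO Hf z Hz; destruct (open_disc_subset Omega z HO Hz) as [r [Hr Hsub]].
  destruct (derivative_differentiable z r f (C_derive f) Hr) as [l Hl].
  - intros w Hw; apply holomorphic_C_diff with Omega; auto.
  - apply C_diff_ex_derive with l; auto.
Qed.

Lemma holomorphic_derive_n (Omega : C -> Prop) (f : C -> C) (l : nat) :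
  open Omega -> holomorphic Omega f -> holomorphic Omega (C_derive_n l f).
Proof.
  intros HO Hf; induction l as [|l IH]; [exact Hf|]; apply holomorphic_derive; auto.
Qed.

(** The induction differentiates an identity between functions, so it needs the identity on a disc
    about [z]; openness of [Omega] supplies one. *)
Lemma C_derive_n_fplus (Omega : C -> Prop) (f g : C -> C) (l : nat) (z : C) :
  open Omega -> holomorphic Omega f -> holomorphic Omega g -> Omega z ->
  C_derive_n l (fplus f g) z = (C_derive_n l f z + C_derive_n l g z)%C.
Proof.
  intros HO Hf Hg; revert z; induction l as [|l IH]; intros z Hz; [reflexivity|].
  apply C_derive_eq.
  destruct (open_disc_subset Omega z HO Hz) as [r [Hr Hsub]].
  apply (C_diff_ext (fun w => C_derive_n l f w + C_derive_n l g w)%C _ _ _ r); auto.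
  - intros w Hw; symmetry; apply IH, Hsub; unfold Cdisc; lra.
  - apply C_diff_plus; apply holomorphic_C_diff with Omega; auto;
      apply holomorphic_derive_n; auto.
Qed.

Lemma C_derive_n_fscal (Omega : C -> Prop) (c : C) (f : C -> C) (l : nat) (z : C) :
  open Omega -> holomorphic Omega f -> Omega z ->
  C_derive_n l (fscal c f) z = (c * C_derive_n l f z)%C.
Proof.
  intros HO Hf; revert z; induction l as [|l IH]; intros z Hz; [reflexivity|].
  apply C_derive_eq.
  destruct (open_disc_subset Omega z HO Hz) as [r [Hr Hsub]].
  apply (C_diff_ext (fun w => c * C_derive_n l f w)%C _ _ _ r); auto.
  - intros w Hw; symmetry; apply IH, Hsub; unfold Cdisc; lra.
  - apply C_diff_scal; apply holomorphic_C_diff with Omega; auto.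
    apply holomorphic_derive_n; auto.
Qed.

Lemma fminus_fplus_fscal (f g : C -> C) : fminus f g = fplus f (fscal (-1) g).
Proof.
  apply functional_extensionality; intros w; unfold fminus, fplus, fscal; ring.
Qed.

Lemma holomorphic_fplus (Omega : C -> Prop) (f g : C -> C) :
  holomorphic Omega f -> holomorphic Omega g -> holomorphic Omega (fplus f g).
Proof.
  intros Hf Hg z Hz; apply C_diff_ex_derive with (C_derive f z + C_derive g z)%C.
  apply C_diff_plus; apply holomorphic_C_diff with Omega; auto.
Qed.

Lemma holomorphic_fscal (Omega : C -> Prop) (c : C) (f : C -> C) :
  holomorphic Omega f -> holomorphic Omega (fscal c f).
Proof.
  intros Hf z Hz; apply C_diff_ex_derive with (c * C_derive f z)%C.
  apply C_diff_scal; apply holomorphic_C_diff with Omega; auto.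
Qed.

Lemma C_derive_n_fminus (Omega : C -> Prop) (f g : C -> C) (l : nat) (z : C) :
  open Omega -> holomorphic Omega f -> holomorphic Omega g -> Omega z ->
  C_derive_n l (fminus f g) z = (C_derive_n l f z - C_derive_n l g z)%C.
Proof.
  intros HO Hf Hg Hz; rewrite fminus_fplus_fscal.
  rewrite (C_derive_n_fplus Omega) by (auto; apply holomorphic_fscal; auto).
  rewrite (C_derive_n_fscal Omega) by auto; ring.
Qed.

Lemma holomorphic_mean_value (Omega : C -> Prop) (f : C -> C) (c a b : C) (r M : R) :
  open Omega -> holomorphic Omega f -> (forall w, Cdisc c r w -> Omega w) ->
  (forall w, Cdisc c r w -> Cmod (C_derive f w) <= M) -> Cdisc c r a -> Cdisc c r b ->
  Cmod (f b - f a) <= M * Cmod (b - a).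
Proof.
  intros HO Hf Hsub HM Ha Hb.
  assert (Hc : cont_on_set (Cdisc c r) (C_derive f)).
  { intros w Hw; apply C_diff_cont with (C_derive (C_derive f) w).
    apply holomorphic_C_diff with Omega; auto; apply holomorphic_derive; auto. }
  rewrite <- (segment_integral_derive (Cdisc c r) f (C_derive f) a b); auto.
  - rewrite Rmult_comm; apply segment_integral_bound with (Cdisc c r); auto.
    + apply disc_convex.
    + intros t Ht; apply HM, disc_convex; auto.
  - apply disc_convex.
  - intros w Hw; apply holomorphic_C_diff with Omega; auto.
Qed.

(** * Locally uniform convergence of holomorphic functions *)

Definition loc_unif_cauchy (Omega : C -> Prop) (u : nat -> C -> C) : Prop :=
  forall w, Omega w -> exists r, 0 < r /\ (forall v, Cdisc w r v -> Omega v) /\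
    forall eps, 0 < eps -> exists N, forall m n, (N <= m)%nat -> (N <= n)%nat ->
      forall v, Cdisc w r v -> Cmod (u m v - u n v) <= eps.

Lemma loc_unif_cauchy_pointwise (Omega : C -> Prop) (u : nat -> C -> C) (w : C) :
  loc_unif_cauchy Omega u -> Omega w -> C_seq_cauchy (fun n => u n w).
Proof.
  intros Hu Hw eps Heps; destruct (Hu w Hw) as [r [Hr [_ H]]].
  destruct (H eps Heps) as [N HN]; exists N; intros m n Hm Hn; apply HN; auto.
  apply disc_center; lra.
Qed.

Lemma loc_unif_cauchy_derive (Omega : C -> Prop) (u : nat -> C -> C) :
  (forall n, holomorphic Omega (u n)) -> loc_unif_cauchy Omega u ->
  loc_unif_cauchy Omega (fun n => C_derive (u n)).
Proof.
  intros Hol Hu w Hw; destruct (Hu w Hw) as [r [Hr [Hsub H]]].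
  (* One fifth for the distance from [v] to [w] and four for the disc about [v] that the Cauchy
     estimate requires. *)
  assert (Hr5 : 0 < r / 5) by lra.
  exists (r / 5); split; [auto|split].
  - intros v Hv; apply Hsub; unfold Cdisc in *; lra.
  - intros eps Heps; destruct (H (eps * (r / 5))) as [N HN]; [nra|].
    exists N; intros m n Hm Hn v Hv.
    assert (Hvw : forall x, Cdisc v (4 * (r / 5)) x -> Cdisc w r x)
      by (intros x Hx; apply disc_subset with v (4 * (r / 5)); auto; unfold Cdisc in Hv; lra).
    assert (Hd : forall x, Cdisc v (4 * (r / 5)) x ->
      C_diff (fun y => u m y - u n y)%C x (C_derive (u m) x - C_derive (u n) x)%C)
      by (intros x Hx; apply C_diff_minus; apply holomorphic_C_diff with Omega; auto).
    replace eps with (eps * (r / 5) / (r / 5)) by (field; lra).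
    apply (cauchy_estimate v (r / 5) _ (fun y => u m y - u n y)%C); auto.
    + intros x Hx; eexists; apply Hd; auto.
    + intros x Hx; apply HN; auto; apply Hvw; unfold Cdisc in *; lra.
    + apply Hd, disc_center; lra.
Qed.

Lemma C_seq_lim_le (u : nat -> C) (l : C) (M : R) (N : nat) :
  C_seq_lim u l -> (forall n, (N <= n)%nat -> Cmod (u n) <= M) -> Cmod l <= M.
Proof.
  intros Hu HM; apply le_epsilon; intros eps Heps; destruct (Hu eps Heps) as [N' HN'].
  assert (H1 := HM (max N N') ltac:(lia)); assert (H2 := HN' (max N N') ltac:(lia)).
  rewrite Cmod_sym in H2.
  assert (Ht := Cmod_triangle (l - u (max N N')) (u (max N N'))).
  replace (l - u (max N N') + u (max N N'))%C with l in Ht by ring; lra.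
Qed.

Lemma C_seq_lim_plus (u v : nat -> C) (a b : C) :
  C_seq_lim u a -> C_seq_lim v b -> C_seq_lim (fun n => u n + v n)%C (a + b)%C.
Proof.
  intros Hu Hv eps Heps; destruct (Hu (eps / 2)) as [N HN]; [lra|].
  destruct (Hv (eps / 2)) as [N' HN']; [lra|].
  exists (max N N'); intros n Hn.
  replace (u n + v n - (a + b))%C with ((u n - a) + (v n - b))%C by ring.
  eapply Rle_trans; [apply Cmod_triangle|].
  assert (H1 := HN n ltac:(lia)); assert (H2 := HN' n ltac:(lia)); lra.
Qed.

Lemma C_seq_lim_scal (c : C) (u : nat -> C) (a : C) :
  C_seq_lim u a -> C_seq_lim (fun n => c * u n)%C (c * a)%C.
Proof.
  intros Hu eps Heps; assert (Hc := Cmod_ge_0 c).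
  destruct (Hu (eps / (1 + Cmod c))) as [N HN]; [apply Rdiv_lt_0_compat; lra|].
  exists N; intros n Hn; replace (c * u n - c * a)%C with (c * (u n - a))%C by ring.
  rewrite Cmod_mult; specialize (HN n Hn).
  apply Rle_trans with ((1 + Cmod c) * (eps / (1 + Cmod c))).
  - apply Rmult_le_compat; auto; try lra; apply Cmod_ge_0.
  - right; field; lra.
Qed.

Lemma C_seq_lim_minus (u v : nat -> C) (a b : C) :
  C_seq_lim u a -> C_seq_lim v b -> C_seq_lim (fun n => u n - v n)%C (a - b)%C.
Proof.
  intros Hu Hv; replace (a - b)%C with (a + (-1) * b)%C by ring.
  replace (fun n => u n - v n)%C with (fun n => u n + (-1) * v n)%C
    by (apply functional_extensionality; intros; ring).
  apply C_seq_lim_plus; auto; apply C_seq_lim_scal; auto.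
Qed.

Lemma C_seq_lim_const (a : C) : C_seq_lim (fun _ => a) a.
Proof.
  intros eps Heps; exists 0%nat; intros n _.
  replace (a - a)%C with (RtoC 0) by ring; rewrite Cmod_0; lra.
Qed.

(* The mean value inequality for [u m - u N], uniform in [m], controls the first-order
   remainder of the limit by that of the single function [u N]. *)
Lemma loc_unif_limit_diff (Omega : C -> Prop) (u : nat -> C -> C) (f : C -> C) (w L : C) :
  open Omega -> (forall n, holomorphic Omega (u n)) -> loc_unif_cauchy Omega u ->
  (forall v, Omega v -> C_seq_lim (fun n => u n v) (f v)) -> Omega w ->
  C_seq_lim (fun n => C_derive (u n) w) L -> C_diff f w L.
Proof.
  intros HO Hol Hu Hf Hw HL eps Heps.
  destruct (loc_unif_cauchy_derive Omega u Hol Hu w Hw) as [r [Hr [Hsub H]]].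
  (* One third goes to the remainder of [u N], the others to the mean value bound and to the
     difference of the derivatives at [w]. *)
  destruct (H (eps / 3)) as [N HN]; [lra|].
  destruct (holomorphic_C_diff Omega (u N) w (Hol N) Hw (eps / 3)) as [d [Hd Hd']]; [lra|].
  exists (Rmin d r); split; [apply Rmin_pos; auto|]; intros v Hv.
  assert (H1 := Hd' v (Rlt_le_trans _ _ _ Hv (Rmin_l _ _))).
  assert (Hvr : Cdisc w r v)
    by (unfold Cdisc; left; apply (Rlt_le_trans _ _ _ Hv (Rmin_r _ _))).
  assert (Hwr : Cdisc w r w) by (apply disc_center; lra).
  set (x := (u N v - u N w - C_derive (u N) w * (v - w))%C) in *.
  replace (f v - f w - L * (v - w))%C
    with (x + (f v - f w - L * (v - w) - x))%C by ring.
  eapply Rle_trans; [apply Cmod_triangle|].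
  cut (Cmod (f v - f w - L * (v - w) - x) <= 2 * (eps / 3) * Cmod (v - w)); [lra|].
  (* [N] stays fixed while [n] tends to infinity. *)
  apply (C_seq_lim_le (fun n => u n v - u n w - (v - w) * C_derive (u n) w - x)%C _ _ N).
  - rewrite (Cmult_comm L); apply C_seq_lim_minus; [|apply C_seq_lim_const].
    apply C_seq_lim_minus; [|apply C_seq_lim_scal; auto].
    apply C_seq_lim_minus; apply Hf; auto.
  - intros n Hn; unfold x.
    replace (u n v - u n w - (v - w) * C_derive (u n) w -
        (u N v - u N w - C_derive (u N) w * (v - w)))%C
      with ((fminus (u n) (u N) v - fminus (u n) (u N) w) +
        - ((C_derive (u n) w - C_derive (u N) w) * (v - w)))%C by (unfold fminus; ring).
    eapply Rle_trans; [apply Cmod_triangle|]; rewrite Cmod_opp, Cmod_mult.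
    assert (Hm : Cmod (fminus (u n) (u N) v - fminus (u n) (u N) w) <= eps / 3 * Cmod (v - w)).
    { apply holomorphic_mean_value with Omega w r; auto.
      - rewrite fminus_fplus_fscal; apply holomorphic_fplus; auto.
        apply holomorphic_fscal; auto.
      - intros y Hy; change (C_derive (fminus (u n) (u N)) y)
          with (C_derive_n 1 (fminus (u n) (u N)) y).
        rewrite (C_derive_n_fminus Omega); auto. }
    assert (H2 := HN n N Hn (Nat.le_refl N) w Hwr).
    assert (H3 := Cmod_ge_0 (v - w)); nra.
Qed.

Lemma loc_unif_limit_holomorphic (Omega : C -> Prop) (u : nat -> C -> C) (f : C -> C) :
  open Omega -> (forall n, holomorphic Omega (u n)) -> loc_unif_cauchy Omega u ->
  (forall v, Omega v -> C_seq_lim (fun n => u n v) (f v)) -> holomorphic Omega f.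
Proof.
  intros HO Hol Hu Hf w Hw.
  destruct (C_seq_complete (fun n => C_derive (u n) w)) as [L HL].
  { apply (loc_unif_cauchy_pointwise Omega (fun n => C_derive (u n))); auto.
    apply loc_unif_cauchy_derive; auto. }
  apply C_diff_ex_derive with L, (loc_unif_limit_diff Omega u); auto.
Qed.

Lemma loc_unif_cauchy_derive_n (Omega : C -> Prop) (u : nat -> C -> C) (l : nat) :
  open Omega -> (forall n, holomorphic Omega (u n)) -> loc_unif_cauchy Omega u ->
  loc_unif_cauchy Omega (fun n => C_derive_n l (u n)).
Proof.
  intros HO Hol Hu; induction l as [|l IH]; [exact Hu|].
  apply (loc_unif_cauchy_derive Omega (fun n => C_derive_n l (u n))); auto.
  intros n; apply holomorphic_derive_n; auto.
Qed.

Lemma loc_unif_limit_derive_n (Omega : C -> Prop) (u : nat -> C -> C) (f : C -> C) (l : nat) :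
  open Omega -> (forall n, holomorphic Omega (u n)) -> loc_unif_cauchy Omega u ->
  (forall v, Omega v -> C_seq_lim (fun n => u n v) (f v)) ->
  forall v, Omega v -> C_seq_lim (fun n => C_derive_n l (u n) v) (C_derive_n l f v).
Proof.
  intros HO Hol Hu Hf; induction l as [|l IH]; [exact Hf|]; intros v Hv.
  destruct (C_seq_complete (fun n => C_derive_n (S l) (u n) v)) as [L HL].
  { apply (loc_unif_cauchy_pointwise Omega (fun n => C_derive_n (S l) (u n))); auto.
    apply loc_unif_cauchy_derive_n; auto. }
  replace (C_derive_n (S l) f v) with L; auto; symmetry; apply C_derive_eq.
  apply (loc_unif_limit_diff Omega (fun n => C_derive_n l (u n))); auto.
  - intros n; apply holomorphic_derive_n; auto.
  - apply loc_unif_cauchy_derive_n; auto.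
Qed.

(** The point [a] is left free: at the centre it gives uniform convergence on the disc, at an
    arbitrary point it carries pointwise convergence from [a] to [b]. *)
Lemma cauchy_from_derivative (Omega : C -> Prop) (u : nat -> C -> C) (c : C) (r eps : R) :
  open Omega -> (forall n, holomorphic Omega (u n)) -> 0 < r -> 0 < eps ->
  (forall w, Cdisc c r w -> Omega w) ->
  (forall eps, 0 < eps -> exists N, forall m n, (N <= m)%nat -> (N <= n)%nat ->
     forall v, Cdisc c r v -> Cmod (C_derive (u m) v - C_derive (u n) v) <= eps) ->
  exists N, forall m n, (N <= m)%nat -> (N <= n)%nat ->
    forall a b, Cdisc c r a -> Cdisc c r b ->
    Cmod (u m b - u n b) <= Cmod (u m a - u n a) + eps.
Proof.
  intros HO Hol Hr Heps Hsub H.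
  destruct (H (eps / (2 * r))) as [N HN]; [apply Rdiv_lt_0_compat; lra|].
  exists N; intros m n Hm Hn a b Ha Hb.
  assert (Hmv : Cmod (fminus (u m) (u n) b - fminus (u m) (u n) a) <=
    eps / (2 * r) * Cmod (b - a)).
  { apply holomorphic_mean_value with Omega c r; auto.
    - rewrite fminus_fplus_fscal; apply holomorphic_fplus; auto.
      apply holomorphic_fscal; auto.
    - intros y Hy; change (C_derive (fminus (u m) (u n)) y)
        with (C_derive_n 1 (fminus (u m) (u n)) y).
      rewrite (C_derive_n_fminus Omega); auto; apply HN; auto. }
  assert (Hab : Cmod (b - a) <= 2 * r).
  { unfold Cdisc in *; assert (Ht := Cmod_minus_triangle b c a).
    rewrite (Cmod_sym c a) in Ht; lra. }
  assert (He : eps / (2 * r) * Cmod (b - a) <= eps).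
  { replace eps with (eps / (2 * r) * (2 * r)) at 2 by (field; lra).
    apply Rmult_le_compat_l; auto; left; apply Rdiv_lt_0_compat; lra. }
  unfold fminus in Hmv.
  replace (u m b - u n b)%C with ((u m a - u n a) + ((u m b - u n b) - (u m a - u n a)))%C
    by ring.
  eapply Rle_trans; [apply Cmod_triangle|]; lra.
Qed.

Lemma loc_unif_cauchy_integrate (Omega : C -> Prop) (u : nat -> C -> C) :
  open Omega -> (forall n, holomorphic Omega (u n)) ->
  loc_unif_cauchy Omega (fun n => C_derive (u n)) ->
  (forall w, Omega w -> C_seq_cauchy (fun n => u n w)) -> loc_unif_cauchy Omega u.
Proof.
  intros HO Hol Hu Hpt w Hw; destruct (Hu w Hw) as [r [Hr [Hsub H]]].
  exists r; split; [auto|split; [auto|]]; intros eps Heps.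
  destruct (cauchy_from_derivative Omega u w r (eps / 2)) as [N HN]; auto; [lra|].
  destruct (Hpt w Hw (eps / 2)) as [N' HN']; [lra|].
  exists (max N N'); intros m n Hm Hn v Hv.
  assert (H1 := HN m n ltac:(lia) ltac:(lia) w v (disc_center w r ltac:(lra)) Hv).
  assert (H2 := HN' m n ltac:(lia) ltac:(lia)); lra.
Qed.

(** * Connected components *)

Lemma connected_component_exists (Omega : C -> Prop) (w : C) : Omega w ->
  exists S, connected_component Omega S /\ S w.
Proof.
  intros Hw.
  (* The union of all connected subsets of [Omega] through [w]. *)
  set (S := fun v => exists T, connected T /\ (forall x, T x -> Omega x) /\ T w /\ T v).
  assert (HSw : S w).
  { exists (fun v => v = w); repeat split; auto; [|intros x ->; auto].
    intros U V _ _ Hcov [x [-> Hx]] [y [-> Hy]]; exists w; auto. }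
  exists S; split; auto; split; [exists w; auto|split; [|split]].
  - intros v [T [_ [HT [_ Hv]]]]; auto.
  - intros U V HU HV Hcov [x [HSx Ux]] [y [HSy Vy]].
    assert (Hmeet : forall T, connected T -> (forall v, T v -> Omega v) -> T w ->
      (exists v, T v /\ U v) -> (exists v, T v /\ V v) -> exists v, S v /\ U v /\ V v).
    { intros T HTc HT HTw HTU HTV.
      assert (HTS : forall v, T v -> S v) by (intros v Hv; exists T; auto).
      destruct (HTc U V HU HV) as [v [Tv [Uv Vv]]]; auto; exists v; auto. }
    destruct HSx as [T [HTc [HT [HTw HTx]]]], HSy as [T' [HTc' [HT' [HTw' HTy']]]].
    (* [w] lies in [U] or in [V], so one of the two connected sets joins it to a point of the other
       open set. *)
    destruct (Hcov w HSw) as [Hw'|Hw'].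
    + apply (Hmeet T'); auto; [exists w|exists y]; auto.
    + apply (Hmeet T); auto; [exists x|exists w]; auto.
  - intros T HTc HT HST v Hv; exists T; auto.
Qed.

(* A property invariant on small discs cuts [Omega] into two open sets, so it holds or fails
   on a whole component at once. *)
Lemma propagate_on_components (Omega : C -> Prop) (I : nat -> Prop) (comp : nat -> C -> Prop)
    (z : nat -> C) (Q : C -> Prop) :
  open Omega -> components_of Omega I comp -> (forall i, I i -> comp i (z i)) ->
  (forall w, Omega w -> exists r, 0 < r /\ (forall v, Cdisc w r v -> Omega v) /\
     forall a b, Cdisc w r a -> Cdisc w r b -> Q a -> Q b) ->
  (forall i, I i -> Q (z i)) -> forall w, Omega w -> Q w.
Proof.
  intros HO [Hcomp [Hall _]] Hz Hloc HQz w Hw; apply NNPP; intros HQw.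
  destruct (connected_component_exists Omega w Hw) as [S [HS HSw]].
  destruct (Hall S HS) as [i [Hi HSi]].
  destruct (Hcomp i Hi) as [_ [Hsub [Hconn _]]].
  (* Stated for a general [P] to cover [Q] and its negation; for the negation, the invariance of [Q]
     is used with [a] and [b] exchanged. *)
  assert (Hopen : forall P : C -> Prop, (forall w r a b,
      (forall a b, Cdisc w r a -> Cdisc w r b -> Q a -> Q b) ->
      Cdisc w r a -> Cdisc w r b -> P a -> P b) -> open (fun v => Omega v /\ P v)).
  { intros P HP; apply C_open; intros v [Hv Pv].
    destruct (Hloc v Hv) as [r [Hr [Hrsub Hr']]].
    exists r; split; auto; intros x Hx.
    assert (Hx' : Cdisc v r x) by (unfold Cdisc; lra).
    split; auto; apply (HP v r v x); auto; apply disc_center; lra. }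
  destruct (Hconn (fun v => Omega v /\ Q v) (fun v => Omega v /\ ~ Q v))
    as [v [_ [[_ H1] [_ H2]]]]; auto.
  - apply Hopen; intros c r a b H Ha Hb; apply H; auto.
  - apply Hopen; intros c r a b H Ha Hb Hna Hqb; apply Hna; revert Hqb; apply H; auto.
  - intros v Hv; destruct (classic (Q v)); auto.
  - exists (z i); auto.
  - exists w; split; [apply HSi; auto|auto].
Qed.

(** * Metrics from countable families of seminorms *)

Lemma saturation_bounds (x : R) : 0 <= x -> 0 <= x / (1 + x) <= 1.
Proof.
  intros Hx; split.
  - apply Rmult_le_pos; [auto|left; apply Rinv_0_lt_compat; lra].
  - apply (Rmult_le_reg_r (1 + x)); [lra|]; field_simplify; lra.
Qed.

Lemma saturation_le (x y : R) : 0 <= x -> x <= y -> x / (1 + x) <= y / (1 + y).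
Proof.
  intros Hx Hxy; apply (Rmult_le_reg_r ((1 + x) * (1 + y))); [nra|].
  replace (x / (1 + x) * ((1 + x) * (1 + y))) with (x * (1 + y)) by (field; lra).
  replace (y / (1 + y) * ((1 + x) * (1 + y))) with (y * (1 + x)) by (field; lra).
  nra.
Qed.

(** After monotonicity the numerator [y + z] is split, and each denominator is lowered
    separately. *)
Lemma saturation_subadditive (x y z : R) : 0 <= x -> 0 <= y -> 0 <= z -> x <= y + z ->
  x / (1 + x) <= y / (1 + y) + z / (1 + z).
Proof.
  intros Hx Hy Hz Hxyz.
  apply Rle_trans with ((y + z) / (1 + (y + z))); [apply saturation_le; lra|].
  replace ((y + z) / (1 + (y + z))) with (y / (1 + (y + z)) + z / (1 + (y + z)))
    by (field; lra).
  apply Rplus_le_compat; apply Rmult_le_compat_l; auto; apply Rinv_le_contravar; lra.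
Qed.

Lemma saturation_lt_inv (x eps : R) : 0 <= x -> 0 < eps ->
  x / (1 + x) < eps / (1 + eps) -> x < eps.
Proof.
  intros Hx He H; apply Rnot_le_lt; intros Hle.
  assert (Hc := saturation_le eps x (Rlt_le _ _ He) Hle); lra.
Qed.

Lemma is_series_half_pow : is_series (fun k => (/ 2) ^ S k) 1.
Proof.
  assert (H := is_series_geom (/ 2)); rewrite Rabs_pos_eq in H by lra.
  specialize (H ltac:(lra)).
  apply (is_series_scal (/ 2)) in H.
  replace 1 with (scal (/ 2) (/ (1 - / 2))) by (unfold scal; simpl; unfold mult; simpl; field).
  exact H.
Qed.

(** The cut-off keeps the indices of the full series, so that the tail can be added termwise to the
    bound for the first [K] terms in [dist_le]. *)
Lemma is_series_half_pow_tail (K : nat) :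
  is_series (fun k => if Nat.ltb k K then 0 else (/ 2) ^ S k) ((/ 2) ^ K).
Proof.
  induction K as [|K IH].
  - simpl pow at 2; apply (is_series_ext (fun k => (/ 2) ^ S k)); [|apply is_series_half_pow].
    intros k; auto.
  - apply (is_series_scal (/ 2)) in IH.
    apply is_series_decr_1.
    match goal with |- is_series _ ?x => replace x with (scal (/ 2) ((/ 2) ^ K)) end.
    + eapply is_series_ext; [|apply IH]; intros k; simpl.
      change (Nat.ltb (S k) (S K)) with (Nat.ltb k K).
      destruct (Nat.ltb k K); unfold scal; simpl; unfold mult; simpl; ring.
    + unfold scal, plus, opp, mult; simpl; unfold mult; simpl; ring.
Qed.

Lemma Rlt_half_pow (eps : R) : 0 < eps -> exists K, (/ 2) ^ K < eps.
Proof.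
  intros He; destruct (pow_lt_1_zero (/ 2)) with (y := eps) as [K HK]; auto.
  - rewrite Rabs_pos_eq; lra.
  - exists K; specialize (HK K (Nat.le_refl K)); rewrite Rabs_pos_eq in HK; auto.
    apply pow_le; lra.
Qed.

Lemma ex_series_bounded_half_pow (t : nat -> R) : (forall k, 0 <= t k <= 1) ->
  ex_series (fun k => (/ 2) ^ S k * t k).
Proof.
  intros Ht; apply (ex_series_le (K := R_AbsRing) (V := R_CompleteNormedModule) _
    (fun k => (/ 2) ^ S k)).
  - intros k; change (Rabs ((/ 2) ^ S k * t k) <= (/ 2) ^ S k).
    assert (Hp : 0 < (/ 2) ^ S k) by (apply pow_lt; lra).
    specialize (Ht k); rewrite Rabs_pos_eq; nra.
  - exists 1; apply is_series_half_pow.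
Qed.

Lemma Series_term_le (a : nat -> R) (n : nat) :
  (forall k, 0 <= a k) -> ex_series a -> a n <= Series a.
Proof.
  intros Ha Hex.
  rewrite (Series_incr_n a (S n)) by (auto; lia).
  apply Rle_trans with (sum_f_R0 a n).
  - destruct n as [|n]; simpl; [lra|].
    assert (H := cond_pos_sum a n Ha); lra.
  - rewrite <- (Rplus_0_r (sum_f_R0 a n)) at 1; apply Rplus_le_compat_l.
    assert (Hex' : ex_series (fun k => a (S n + k)%nat))
      by (apply (ex_series_incr_n a (S n)); auto).
    rewrite <- (Rmult_0_l (Series (fun k => a (S n + k)%nat))), <- Series_scal_l.
    apply Series_le; auto; intros k; specialize (Ha (S n + k)%nat); lra.
Qed.

Section SeminormMetric.

Context {J : Type} (A : (C -> C) -> Prop) (P : J -> Prop) (p : J -> (C -> C) -> Rbar)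
  (e : nat -> J).
Hypothesis A_linear : linear_subspace A.
Hypothesis p_seminorm : forall j, P j -> is_seminorm A (p j).
Hypothesis e_enum : enumerates e P.

Let d := seminorm_dist p e.
Let q (k : nat) (f g : C -> C) : R := real (p (e k) (fminus f g)).

Lemma subspace_fminus (f g : C -> C) : A f -> A g -> A (fminus f g).
Proof.
  intros Hf Hg; destruct A_linear as [_ [Hp Hs]]; rewrite fminus_fplus_fscal; auto.
Qed.

Lemma seminorm_nonneg (j : J) (f : C -> C) : P j -> A f -> 0 <= real (p j f).
Proof. intros Hj Hf; apply (proj1 (p_seminorm j Hj)); auto. Qed.

Lemma seminorm_fminus_sym (j : J) (f g : C -> C) : P j -> A f -> A g ->
  real (p j (fminus f g)) = real (p j (fminus g f)).
Proof.
  intros Hj Hf Hg; destruct (p_seminorm j Hj) as [_ [_ Hs]].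
  replace (fminus f g) with (fscal (-1) (fminus g f)).
  - rewrite Hs by (apply subspace_fminus; auto); rewrite Cmod_R, Rabs_left; lra.
  - apply functional_extensionality; intros w; unfold fscal, fminus; ring.
Qed.

Lemma seminorm_fminus_triangle (j : J) (f g h : C -> C) : P j -> A f -> A g -> A h ->
  real (p j (fminus f h)) <= real (p j (fminus f g)) + real (p j (fminus g h)).
Proof.
  intros Hj Hf Hg Hh; destruct (p_seminorm j Hj) as [_ [Ht _]].
  replace (fminus f h) with (fplus (fminus f g) (fminus g h)).
  - apply Ht; apply subspace_fminus; auto.
  - apply functional_extensionality; intros w; unfold fplus, fminus; ring.
Qed.

Lemma q_nonneg (k : nat) (f g : C -> C) : A f -> A g -> 0 <= q k f g.
Proof.
  intros Hf Hg; apply seminorm_nonneg; [apply (proj1 e_enum)|apply subspace_fminus; auto].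
Qed.

Lemma term_bounds (f g : C -> C) : A f -> A g ->
  forall k, 0 <= q k f g / (1 + q k f g) <= 1.
Proof. intros Hf Hg k; apply saturation_bounds, q_nonneg; auto. Qed.

Lemma dist_ex_series (f g : C -> C) : A f -> A g ->
  ex_series (fun k => (/ 2) ^ S k * (q k f g / (1 + q k f g))).
Proof. intros Hf Hg; apply ex_series_bounded_half_pow, term_bounds; auto. Qed.

Lemma term_nonneg (f g : C -> C) : A f -> A g ->
  forall k, 0 <= (/ 2) ^ S k * (q k f g / (1 + q k f g)).
Proof.
  intros Hf Hg k; apply Rmult_le_pos; [apply pow_le; lra|apply term_bounds; auto].
Qed.

Lemma term_le_dist (f g : C -> C) (k : nat) : A f -> A g ->
  (/ 2) ^ S k * (q k f g / (1 + q k f g)) <= d f g.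
Proof.
  intros Hf Hg.
  apply (Series_term_le (fun k => (/ 2) ^ S k * (q k f g / (1 + q k f g)))).
  - apply term_nonneg; auto.
  - apply dist_ex_series; auto.
Qed.

(** Since [x / (1 + x)] is at most both [x] and 1, the first [K] terms sum to at most [eps] and the
    others to at most [(/ 2) ^ K]. *)
Lemma dist_le (f g : C -> C) (eps : R) (K : nat) : A f -> A g -> 0 <= eps ->
  (forall k, (k < K)%nat -> q k f g <= eps) -> d f g <= eps + (/ 2) ^ K.
Proof.
  intros Hf Hg He HK.
  assert (Hs : is_series (fun k => eps * (/ 2) ^ S k + (if Nat.ltb k K then 0 else (/ 2) ^ S k))
    (eps * 1 + (/ 2) ^ K)).
  { apply (is_series_plus (V := R_NormedModule)); [|apply is_series_half_pow_tail].
    apply (is_series_scal (V := R_NormedModule) eps), is_series_half_pow. }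
  rewrite <- (Rmult_1_r eps), <- (is_series_unique _ _ Hs).
  apply Series_le; [|eexists; apply Hs].
  intros k; fold (q k f g); split; [apply term_nonneg; auto|].
  assert (Hp : 0 < (/ 2) ^ S k) by (apply pow_lt; lra).
  assert (Ht := term_bounds f g Hf Hg k).
  destruct (Nat.ltb_spec k K) as [Hk|Hk]; [|nra].
  specialize (HK k Hk); assert (Hq := q_nonneg k f g Hf Hg).
  assert (Hle : q k f g / (1 + q k f g) <= q k f g).
  { apply (Rmult_le_reg_r (1 + q k f g)); [lra|]; field_simplify; nra. }
  nra.
Qed.

(** A single term is a lower bound for the distance. This and [dist_lt_of_seminorms] translate open
    sets and Cauchy sequences between the metric and the seminorms. *)
Lemma seminorm_lt_of_dist (j : J) (eps : R) : P j -> 0 < eps ->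
  exists eta, 0 < eta /\ forall f g, A f -> A g -> d f g < eta ->
    real (p j (fminus f g)) < eps.
Proof.
  intros Hj He; destruct (proj2 e_enum j Hj) as [k Hk].
  assert (Hp : 0 < (/ 2) ^ S k) by (apply pow_lt; lra).
  exists ((/ 2) ^ S k * (eps / (1 + eps))); split.
  - apply Rmult_lt_0_compat; auto; apply Rdiv_lt_0_compat; lra.
  - intros f g Hf Hg Hd; subst j; change (q k f g < eps).
    apply saturation_lt_inv; auto; [apply q_nonneg; auto|].
    apply (Rmult_lt_reg_l ((/ 2) ^ S k)); auto.
    eapply Rle_lt_trans; [apply term_le_dist; auto|auto].
Qed.

Lemma dist_lt_of_seminorms (eps : R) : 0 < eps ->
  exists K eta, 0 < eta /\ forall f g, A f -> A g ->
    (forall k, (k < K)%nat -> real (p (e k) (fminus f g)) <= eta) -> d f g < eps.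
Proof.
  intros He; destruct (Rlt_half_pow (eps / 2)) as [K HK]; [lra|].
  exists K, (eps / 2); split; [lra|]; intros f g Hf Hg H.
  eapply Rle_lt_trans; [apply (dist_le f g (eps / 2) K); auto; lra|lra].
Qed.

Hypothesis p_separates :
  forall f, A f -> (forall j, P j -> real (p j f) = 0) -> f = (fun _ => RtoC 0).

Lemma seminorm_dist_metric : is_metric A d.
Proof.
  split; [|split; [|split]].
  - intros f g Hf Hg; eapply Rle_trans; [apply (term_nonneg f g Hf Hg 0)|].
    apply term_le_dist; auto.
  - intros f g Hf Hg; split.
    + intros Hd; apply functional_extensionality; intros w.
      assert (E : fminus f g = (fun _ => RtoC 0)).
      { apply p_separates; [apply subspace_fminus; auto|]; intros j Hj.
        apply Rle_antisym; [|apply seminorm_nonneg; auto; apply subspace_fminus; auto].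
        apply le_epsilon; intros eps Heps.
        destruct (seminorm_lt_of_dist j eps Hj Heps) as [eta [Heta H]].
        specialize (H f g Hf Hg); rewrite Hd in H; specialize (H Heta); lra. }
      apply Ceq_minus; exact (f_equal (fun h => h w) E).
    + intros <-; unfold d, seminorm_dist.
      rewrite (Series_ext _ (fun k => 0 * (/ 2) ^ S k)).
      * rewrite Series_scal_l; ring.
      * intros k; replace (real (p (e k) (fminus f f))) with 0; [field|].
        symmetry; destruct (p_seminorm (e k) (proj1 e_enum k)) as [_ [_ Hs]].
        replace (fminus f f) with (fscal 0 f).
        -- rewrite Hs by auto; rewrite Cmod_0; ring.
        -- apply functional_extensionality; intros w; unfold fscal, fminus; ring.
  - intros f g Hf Hg; apply Series_ext; intros k.
    rewrite seminorm_fminus_sym; auto; apply (proj1 e_enum).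
  - intros f g h Hf Hg Hh; unfold d, seminorm_dist.
    rewrite <- Series_plus by (apply dist_ex_series; auto).
    apply Series_le.
    + intros k; split; [apply term_nonneg; auto|].
      rewrite <- Rmult_plus_distr_l; apply Rmult_le_compat_l; [apply pow_le; lra|].
      apply saturation_subadditive; try apply q_nonneg; auto.
      apply seminorm_fminus_triangle; auto; apply (proj1 e_enum).
    + apply (ex_series_plus (V := R_NormedModule)); apply dist_ex_series; auto.
Qed.

Lemma seminorm_dist_translation : translation_invariant A d.
Proof.
  intros f g h _ _ _; apply Series_ext; intros k.
  replace (fminus (fplus f h) (fplus g h)) with (fminus f g); auto.
  apply functional_extensionality; intros w; unfold fplus, fminus; ring.
Qed.

Lemma seminorm_dist_topology (U : (C -> C) -> Prop) :
  seminorm_open A P p U <-> metric_open A d U.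
Proof.
  (* [seminorm_open] measures [g - f], while [metric_open] uses [d f g], built on [f - g]. *)
  assert (Hsym := proj1 (proj2 (proj2 seminorm_dist_metric))).
  split; intros HU f Hf Uf; destruct (HU f Hf Uf) as [x Hx]; clear HU.
  - destruct Hx as [eps [Hs [Heps H]]].
    assert (Hlist : exists eta, 0 < eta /\ forall g, A g -> d f g < eta ->
      List.Forall (fun j => real (p j (fminus g f)) < eps) x).
    { clear H; induction Hs as [|j s Hj Hs [eta [Heta IH]]].
      - exists 1; split; [lra|]; intros; constructor.
      - destruct (seminorm_lt_of_dist j eps Hj Heps) as [eta' [Heta' H']].
        exists (Rmin eta eta'); split; [apply Rmin_pos; auto|]; intros g Hg Hd.
        constructor.
        + apply H'; auto; rewrite Hsym by auto.
          eapply Rlt_le_trans; [apply Hd|apply Rmin_r].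
        + apply IH; auto; eapply Rlt_le_trans; [apply Hd|apply Rmin_l]. }
    destruct Hlist as [eta [Heta Hl]]; exists eta; split; auto.
  - destruct Hx as [Hx H].
    destruct (dist_lt_of_seminorms x Hx) as [K [eta [Heta HK]]].
    exists (map e (seq 0 K)), eta; split; [|split; auto].
    + apply List.Forall_forall; intros j Hj; apply in_map_iff in Hj.
      destruct Hj as [k [<- _]]; apply (proj1 e_enum).
    + intros g Hg Hall; apply H; auto; rewrite Hsym by auto; apply HK; auto.
      intros k Hk; left; rewrite List.Forall_forall in Hall; apply Hall, in_map, in_seq; lia.
Qed.

Hypothesis p_complete : forall u : nat -> C -> C, (forall n, A (u n)) ->
  (forall j, P j -> forall eps, 0 < eps -> exists N, forall m n, (N <= m)%nat -> (N <= n)%nat ->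
     real (p j (fminus (u m) (u n))) <= eps) ->
  exists f, A f /\ forall j, P j -> forall eps, 0 < eps -> exists N, forall n, (N <= n)%nat ->
     real (p j (fminus (u n) f)) <= eps.

Lemma seminorm_dist_complete : is_complete A d.
Proof.
  intros u Hu Hcauchy; destruct (p_complete u Hu) as [f [Hf Hlim]].
  { intros j Hj eps Heps; destruct (seminorm_lt_of_dist j eps Hj Heps) as [eta [Heta H]].
    destruct (Hcauchy eta Heta) as [N HN]; exists N; intros m n Hm Hn; left.
    apply H; auto. }
  exists f; split; auto; apply is_lim_seq_spec; intros eps.
  destruct (dist_lt_of_seminorms eps (cond_pos eps)) as [K [eta [Heta HK]]].
  assert (HN : exists N, forall n, (N <= n)%nat -> forall k, (k < K)%nat ->
    real (p (e k) (fminus (u n) f)) <= eta).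
  { clear HK; induction K as [|K [N IH]].
    - exists 0%nat; intros; lia.
    - destruct (Hlim (e K) (proj1 e_enum K) eta Heta) as [N' HN'].
      exists (max N N'); intros n Hn k Hk.
      destruct (Nat.eq_dec k K) as [->|Hne]; [apply HN'; lia|apply IH; lia]. }
  destruct HN as [N HN]; exists N; intros n Hn; rewrite Rminus_0_r, Rabs_pos_eq.
  - apply HK; auto.
  - apply (proj1 seminorm_dist_metric); auto.
Qed.

Theorem frechet_of_seminorms : frechet_space A P p d.
Proof.
  split; [exact A_linear|split; [exact p_seminorm|split; [exact seminorm_dist_metric|]]].
  split; [exact seminorm_dist_translation|split; [exact seminorm_dist_topology|]].
  exact seminorm_dist_complete.
Qed.

End SeminormMetric.

(** * The space A_F *)

Lemma closure_adherent (S : C -> Prop) (z : C) : closure S z <-> adherent S z.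
Proof.
  split.
  - intros H eps Heps.
    destruct (H (fun w => Cmod (w - z) <= eps)) as [w [Hw Sw]]; [|exists w; auto].
    apply C_locally; exists eps; split; auto; intros w Hw; lra.
  - intros H P HP; apply C_locally in HP; destruct HP as [d [Hd HP]].
    destruct (H (d / 2)) as [w [Sw Hw]]; [lra|]; exists w; split; auto; apply HP; lra.
Qed.

Lemma closure_subset (S : C -> Prop) (z : C) : S z -> closure S z.
Proof.
  intros Hz; apply closure_adherent; intros eps Heps; exists z; split; auto.
  replace (z - z)%C with (RtoC 0) by ring; rewrite Cmod_0; lra.
Qed.

Lemma closure_closed (S : C -> Prop) (z : C) : adherent (closure S) z -> closure S z.
Proof.
  intros H; apply closure_adherent; intros eps Heps.
  destruct (H (eps / 2)) as [w [Hw Hwz]]; [lra|].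
  destruct (proj1 (closure_adherent S w) Hw (eps / 2)) as [v [Hv Hvw]]; [lra|].
  exists v; split; auto; assert (Ht := Cmod_minus_triangle v w z); lra.
Qed.

(** In contrast to [cont_on_set], this continuity is relative to [D]: values of [g] outside [D] do
    not count. *)
Lemma C_continuous_on (D : C -> Prop) (g : C -> C) :
  continuous_on D g <-> forall z, D z -> forall eps, 0 < eps -> exists d, 0 < d /\
    forall w, D w -> Cmod (w - z) < d -> Cmod (g w - g z) <= eps.
Proof.
  split; intros H z Hz.
  - intros eps Heps.
    assert (HP : locally (g z) (fun y => Cmod (y - g z) <= eps)).
    { apply C_locally; exists eps; split; auto; intros y Hy; lra. }
    specialize (H z Hz _ HP); apply C_locally in H; destruct H as [d [Hd H]].
    exists d; split; auto.
  - intros P HP; apply C_locally in HP; destruct HP as [eps [Heps HP]].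
    destruct (H z Hz (eps / 2)) as [d [Hd Hd']]; [lra|].
    apply C_locally; exists d; split; auto; intros w Hw Dw; apply HP.
    specialize (Hd' w Dw Hw); lra.
Qed.

Lemma continuous_on_fplus (D : C -> Prop) (f g : C -> C) :
  continuous_on D f -> continuous_on D g -> continuous_on D (fplus f g).
Proof.
  rewrite !C_continuous_on; intros Hf Hg z Hz eps Heps.
  destruct (Hf z Hz (eps / 2)) as [d [Hd H]]; [lra|].
  destruct (Hg z Hz (eps / 2)) as [d' [Hd' H']]; [lra|].
  exists (Rmin d d'); split; [apply Rmin_pos; auto|]; intros w Dw Hw.
  assert (H1 := H w Dw (Rlt_le_trans _ _ _ Hw (Rmin_l _ _))).
  assert (H2 := H' w Dw (Rlt_le_trans _ _ _ Hw (Rmin_r _ _))).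
  unfold fplus; replace (f w + g w - (f z + g z))%C with ((f w - f z) + (g w - g z))%C by ring.
  eapply Rle_trans; [apply Cmod_triangle|]; lra.
Qed.

Lemma continuous_on_fscal (D : C -> Prop) (c : C) (f : C -> C) :
  continuous_on D f -> continuous_on D (fscal c f).
Proof.
  rewrite !C_continuous_on; intros Hf z Hz eps Heps; assert (Hc := Cmod_ge_0 c).
  destruct (Hf z Hz (eps / (1 + Cmod c))) as [d [Hd H]]; [apply Rdiv_lt_0_compat; lra|].
  exists d; split; auto; intros w Dw Hw; specialize (H w Dw Hw).
  unfold fscal; replace (c * f w - c * f z)%C with (c * (f w - f z))%C by ring.
  rewrite Cmod_mult; apply Rle_trans with ((1 + Cmod c) * (eps / (1 + Cmod c))).
  - apply Rmult_le_compat; auto; try lra; apply Cmod_ge_0.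
  - right; field; lra.
Qed.

Lemma continuous_on_closure_unique (S : C -> Prop) (f g : C -> C) :
  continuous_on (closure S) f -> continuous_on (closure S) g ->
  (forall z, S z -> f z = g z) -> forall z, closure S z -> f z = g z.
Proof.
  rewrite !C_continuous_on; intros Hf Hg Hfg z Hz; apply Ceq_minus, Cmod_le_eps_0.
  intros eps Heps.
  destruct (Hf z Hz (eps / 2)) as [d [Hd H]]; [lra|].
  destruct (Hg z Hz (eps / 2)) as [d' [Hd' H']]; [lra|].
  destruct (proj1 (closure_adherent S z) Hz (Rmin d d' / 2)) as [w [Sw Hw]].
  { assert (Hm := Rmin_pos _ _ Hd Hd'); lra. }
  assert (Hm := Rmin_pos _ _ Hd Hd').
  assert (Hl := Rmin_l d d'); assert (Hr := Rmin_r d d').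
  assert (H1 := H w (closure_subset S w Sw) ltac:(lra)).
  assert (H2 := H' w (closure_subset S w Sw) ltac:(lra)).
  rewrite (Hfg w Sw), Cmod_sym in H1.
  assert (Ht := Cmod_minus_triangle (f z) (g w) (g z)); lra.
Qed.

Lemma C_seq_lim_unique (u : nat -> C) (a b : C) : C_seq_lim u a -> C_seq_lim u b -> a = b.
Proof.
  intros Ha Hb; apply Ceq_minus, Cmod_le_eps_0; intros eps Heps.
  destruct (Ha (eps / 2)) as [N HN]; [lra|]; destruct (Hb (eps / 2)) as [N' HN']; [lra|].
  assert (H1 := HN (max N N') ltac:(lia)); assert (H2 := HN' (max N N') ltac:(lia)).
  rewrite Cmod_sym in H1; assert (Ht := Cmod_minus_triangle a (u (max N N')) b); lra.
Qed.

(** The admissible radii at [z] are kept below [/ (1 + Cmod (g z))], so that a uniform lower bound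
    [d] for the radii turns into the bound [/ d] for [g]. *)
Lemma continuous_on_compact_bounded (K : C -> Prop) (B : R) (g : C -> C) :
  (forall z, adherent K z -> K z) -> (forall z, K z -> Cmod z <= B) -> continuous_on K g ->
  exists M, 0 <= M /\ forall z, K z -> Cmod (g z) <= M.
Proof.
  intros Hclosed HB Hg; rewrite C_continuous_on in Hg.
  destruct (lebesgue_number K B (fun z r => r <= / (1 + Cmod (g z)) /\
    forall w, K w -> Cmod (w - z) < r -> Cmod (g w - g z) <= 1)) as [d [Hd H]]; auto.
  - intros z Hz; destruct (Hg z Hz 1) as [d [Hd H]]; [lra|].
    assert (Hgz := Cmod_ge_0 (g z)).
    exists (Rmin d (/ (1 + Cmod (g z)))); split; [|split].
    + apply Rmin_pos; auto; apply Rinv_0_lt_compat; lra.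
    + apply Rmin_r.
    + intros w Kw Hw; apply H; auto; eapply Rlt_le_trans; [apply Hw|apply Rmin_l].
  - exists (/ d); split; [left; apply Rinv_0_lt_compat; auto|]; intros z Kz.
    destruct (H z Kz) as [u [r [Ku [[Hr Hu] [Hzu Hdr]]]]].
    specialize (Hu z Kz Hzu); assert (Hgu := Cmod_ge_0 (g u)).
    assert (Hi : 1 + Cmod (g u) <= / d).
    { rewrite <- (Rinv_inv (1 + Cmod (g u))); apply Rinv_le_contravar; lra. }
    assert (Ht := Cmod_triangle (g z - g u) (g u)).
    replace (g z - g u + g u)%C with (g z) in Ht by ring; lra.
Qed.

(** [M] must be nonnegative because 0 is among the values whose supremum is taken. *)
Lemma sup_spec (K : C -> Prop) (b : R) (g : C -> C) (M : R) : 0 <= M ->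
  (forall w, K w -> Cmod w <= b -> Cmod (g w) <= M) ->
  let s := Lub_Rbar (fun r => r = 0 \/ exists w, K w /\ Cmod w <= b /\ r = Cmod (g w)) in
  is_finite s /\ 0 <= real s /\ real s <= M /\
  forall w, K w -> Cmod w <= b -> Cmod (g w) <= real s.
Proof.
  intros HM Hg s.
  destruct (Lub_Rbar_correct
    (fun r => r = 0 \/ exists w, K w /\ Cmod w <= b /\ r = Cmod (g w))) as [Hub Hlub].
  fold s in Hub, Hlub.
  assert (Hs0 := Hub 0 (or_introl eq_refl)).
  assert (HsM : Rbar_le s M).
  { apply Hlub; intros r [->|[w [Kw [Hw ->]]]]; simpl; auto. }
  destruct s as [x| |]; simpl in Hs0, HsM; try contradiction.
  split; [reflexivity|split; [auto|split; [auto|]]].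
  intros w Kw Hw; apply (Hub (Cmod (g w))); right; exists w; auto.
Qed.

Lemma least_element (F : nat -> Prop) : (exists l, F l) ->
  exists l, F l /\ forall m, F m -> (l <= m)%nat.
Proof.
  intros [l Hl]; induction l as [l IH] using (well_founded_induction Wf_nat.lt_wf).
  destruct (classic (exists m, F m /\ (m < l)%nat)) as [[m [Hm Hml]]|H].
  - apply (IH m); auto.
  - exists l; split; auto; intros m Hm; apply Nat.le_ngt; intros Hml; apply H; exists m; auto.
Qed.

(** * Extensions of derivatives and the natural seminorms *)

Section HolomorphicSpace.

Context (Omega : C -> Prop) (F : nat -> Prop).
Hypothesis Omega_open : open Omega.

Let ext (l : nat) (f : C -> C) : C -> C := extension Omega (C_derive_n l f).

Lemma extension_spec (l : nat) (f : C -> C) : A_F Omega F f -> F l ->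
  continuous_extension Omega (C_derive_n l f) (ext l f).
Proof. intros [_ [_ Hf]] Hl; exact (epsilon_spec _ _ (proj2 (Hf l Hl))). Qed.

(** [extension] picks some continuous extension; density of [Omega] fixes its values on the closure.
    Linearity of the extension follows by exhibiting the linear combination as another extension. *)
Lemma extension_unique (l : nat) (f g : C -> C) (z : C) : A_F Omega F f -> F l ->
  continuous_extension Omega (C_derive_n l f) g -> closure Omega z -> ext l f z = g z.
Proof.
  intros Hf Hl [Hg1 Hg2]; destruct (extension_spec l f Hf Hl) as [H1 H2].
  apply continuous_on_closure_unique; auto.
  intros w Hw; rewrite H1, Hg1; auto.
Qed.

Lemma continuous_extension_fplus (l : nat) (f g f' g' : C -> C) :
  holomorphic Omega f -> holomorphic Omega g ->
  continuous_extension Omega (C_derive_n l f) f' ->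
  continuous_extension Omega (C_derive_n l g) g' ->
  continuous_extension Omega (C_derive_n l (fplus f g)) (fplus f' g').
Proof.
  intros Hf Hg [H1 H2] [H3 H4]; split; [|apply continuous_on_fplus; auto].
  intros z Hz; rewrite (C_derive_n_fplus Omega) by auto.
  unfold fplus; rewrite H1, H3; auto.
Qed.

Lemma continuous_extension_fscal (l : nat) (c : C) (f f' : C -> C) :
  holomorphic Omega f -> continuous_extension Omega (C_derive_n l f) f' ->
  continuous_extension Omega (C_derive_n l (fscal c f)) (fscal c f').
Proof.
  intros Hf [H1 H2]; split; [|apply continuous_on_fscal; auto].
  intros z Hz; rewrite (C_derive_n_fscal Omega) by auto; unfold fscal; rewrite H1; auto.
Qed.

Lemma A_F_linear : linear_subspace (A_F Omega F).
Proof.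
  assert (Hplus : forall f g, A_F Omega F f -> A_F Omega F g -> A_F Omega F (fplus f g)).
  { intros f g Hf Hg; assert (Hf' := Hf); assert (Hg' := Hg).
    destruct Hf' as [Hf0 [Hfh _]], Hg' as [Hg0 [Hgh _]].
    assert (Hh := holomorphic_fplus Omega f g Hfh Hgh).
    split; [|split; auto].
    - intros z Hz; unfold fplus; rewrite Hf0, Hg0 by auto; ring.
    - intros l Hl; split; [apply holomorphic_derive_n; auto|].
      eexists; apply continuous_extension_fplus; auto; apply extension_spec; auto. }
  assert (Hscal : forall c f, A_F Omega F f -> A_F Omega F (fscal c f)).
  { intros c f Hf; assert (Hf' := Hf); destruct Hf' as [Hf0 [Hfh _]].
    assert (Hh := holomorphic_fscal Omega c f Hfh).
    split; [|split; auto].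
    - intros z Hz; unfold fscal; rewrite Hf0 by auto; ring.
    - intros l Hl; split; [apply holomorphic_derive_n; auto|].
      eexists; apply continuous_extension_fscal; auto; apply extension_spec; auto. }
  split; [|split; auto].
  assert (Hh : holomorphic Omega (fun _ => RtoC 0)).
  { intros z _; apply C_diff_ex_derive with (RtoC 0); intros eps Heps; exists 1; split; [lra|].
    intros w _; replace (0 - 0 - 0 * (w - z))%C with (RtoC 0) by ring.
    rewrite Cmod_0; apply Rmult_le_pos; [lra|apply Cmod_ge_0]. }
  split; [auto|split; [auto|]]; intros l Hl; split; [apply holomorphic_derive_n; auto|].
  exists (fun _ => RtoC 0); split.
  - intros z Hz.
    (* Seen as 0 times itself, the zero function has vanishing derivatives by homogeneity. *)
    replace (fun _ : C => RtoC 0) with (fscal 0 (fun _ => RtoC 0))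
      by (apply functional_extensionality; intros; unfold fscal; ring).
    rewrite (C_derive_n_fscal Omega) by auto; unfold fscal; ring.
  - apply C_continuous_on; intros z _ eps Heps; exists 1; split; [lra|]; intros w _ _.
    replace (0 - 0)%C with (RtoC 0) by ring; rewrite Cmod_0; lra.
Qed.

Lemma A_F_fminus (f g : C -> C) : A_F Omega F f -> A_F Omega F g -> A_F Omega F (fminus f g).
Proof.
  intros Hf Hg; rewrite fminus_fplus_fscal; destruct A_F_linear as [_ [Hp Hs]]; auto.
Qed.

Lemma extension_fplus (l : nat) (f g : C -> C) (z : C) :
  A_F Omega F f -> A_F Omega F g -> F l -> closure Omega z ->
  ext l (fplus f g) z = (ext l f z + ext l g z)%C.
Proof.
  intros Hf Hg Hl Hz.
  change (ext l (fplus f g) z = fplus (ext l f) (ext l g) z).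
  apply extension_unique; auto; [apply A_F_linear; auto|].
  apply continuous_extension_fplus;
    [exact (proj1 (proj2 Hf))|exact (proj1 (proj2 Hg))|apply extension_spec; auto..].
Qed.

Lemma extension_fscal (l : nat) (c : C) (f : C -> C) (z : C) :
  A_F Omega F f -> F l -> closure Omega z -> ext l (fscal c f) z = (c * ext l f z)%C.
Proof.
  intros Hf Hl Hz.
  change (ext l (fscal c f) z = fscal c (ext l f) z).
  apply extension_unique; auto; [apply A_F_linear; auto|].
  apply continuous_extension_fscal; [exact (proj1 (proj2 Hf))|apply extension_spec; auto].
Qed.

Lemma extension_fminus (l : nat) (f g : C -> C) (z : C) :
  A_F Omega F f -> A_F Omega F g -> F l -> closure Omega z ->
  ext l (fminus f g) z = (ext l f z - ext l g z)%C.
Proof.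
  intros Hf Hg Hl Hz; rewrite fminus_fplus_fscal.
  assert (Hg' : A_F Omega F (fscal (-1) g)) by (apply A_F_linear; auto).
  rewrite extension_fplus, extension_fscal by auto; ring.
Qed.

(** The part of the closure in a closed disc is compact, whence the seminorms are finite. *)
Lemma extension_bounded (l n : nat) (f : C -> C) : A_F Omega F f -> F l ->
  exists M, 0 <= M /\ forall w, closure Omega w -> Cmod w <= INR n -> Cmod (ext l f w) <= M.
Proof.
  intros Hf Hl; destruct (extension_spec l f Hf Hl) as [_ Hc].
  destruct (continuous_on_compact_bounded (fun w => closure Omega w /\ Cmod w <= INR n) (INR n)
    (ext l f)) as [M [HM H]].
  - intros z Hz; split.
    + apply closure_closed; intros eps Heps; destruct (Hz eps Heps) as [w [[Hw _] Hwz]].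
      exists w; auto.
    + apply le_epsilon; intros eps Heps; destruct (Hz eps Heps) as [w [[_ Hw] Hwz]].
      assert (Ht := Cmod_triangle (z - w) w); rewrite (Cmod_sym z) in Ht.
      replace (z - w + w)%C with z in Ht by ring; lra.
  - tauto.
  - rewrite C_continuous_on in Hc |- *; intros z [Hz _] eps Heps.
    destruct (Hc z Hz eps Heps) as [d [Hd H]]; exists d; split; auto.
    intros w [Hw _]; auto.
  - exists M; split; auto.
Qed.

(** Later proofs use the supremum only through these properties, without unfolding [Lub_Rbar]. *)
Lemma sup_seminorm_spec (z : nat -> C) (l n : nat) (f : C -> C) : A_F Omega F f -> F l ->
  let s := natural_seminorm Omega z (SupIndex l n) f in
  is_finite s /\ 0 <= real s /\
  (forall w, closure Omega w -> Cmod w <= INR n -> Cmod (ext l f w) <= real s) /\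
  forall M, 0 <= M ->
    (forall w, closure Omega w -> Cmod w <= INR n -> Cmod (ext l f w) <= M) -> real s <= M.
Proof.
  intros Hf Hl s; destruct (extension_bounded l n f Hf Hl) as [M [HM H]].
  destruct (sup_spec (closure Omega) (INR n) (ext l f) M HM H) as [H1 [H2 [_ H3]]].
  split; [auto|split; [auto|split; [auto|]]].
  intros M' HM' H'; apply (sup_spec (closure Omega) (INR n) (ext l f) M' HM' H').
Qed.

Lemma sup_seminorm (z : nat -> C) (l n : nat) : F l ->
  is_seminorm (A_F Omega F) (natural_seminorm Omega z (SupIndex l n)).
Proof.
  intros Hl; destruct A_F_linear as [_ [Hp Hs]].
  set (p := natural_seminorm Omega z (SupIndex l n)).
  assert (Hspec : forall f, A_F Omega F f -> _)
    by (intros f Hf; exact (sup_seminorm_spec z l n f Hf Hl)).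
  fold p in Hspec; cbv zeta in Hspec.
  assert (Hscal : forall c f, A_F Omega F f -> real (p (fscal c f)) <= Cmod c * real (p f)).
  { intros c f Hf; destruct (Hspec f Hf) as [_ [H0 [H _]]].
    apply (Hspec (fscal c f) (Hs c f Hf)).
    - apply Rmult_le_pos; auto; apply Cmod_ge_0.
    - intros w Hw Hn; rewrite extension_fscal, Cmod_mult by auto.
      apply Rmult_le_compat_l; auto; apply Cmod_ge_0. }
  split; [|split].
  - intros f Hf; split; apply (Hspec f Hf).
  - intros f g Hf Hg.
    destruct (Hspec f Hf) as [_ [Hf0 [Hf1 _]]], (Hspec g Hg) as [_ [Hg0 [Hg1 _]]].
    apply (Hspec (fplus f g) (Hp f g Hf Hg)); [lra|].
    intros w Hw Hn; rewrite extension_fplus by auto.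
    eapply Rle_trans; [apply Cmod_triangle|].
    specialize (Hf1 w Hw Hn); specialize (Hg1 w Hw Hn); lra.
  - intros c f Hf; apply Rle_antisym; [auto|].
    destruct (classic (c = 0)) as [->|Hc].
    + rewrite Cmod_0, Rmult_0_l; apply (Hspec (fscal 0 f)); auto.
    (* The reverse inequality is the one already proved, for the factor [/ c] and the function
       [fscal c f]. *)
    + assert (H := Hscal (/ c)%C (fscal c f) (Hs c f Hf)).
      replace (fscal (/ c) (fscal c f)) with f in H
        by (apply functional_extensionality; intros w; unfold fscal; field; auto).
      assert (Hc0 : 0 < Cmod c) by (apply Cmod_gt_0; auto).
      rewrite Cmod_inv in H by auto.
      apply (Rmult_le_compat_l (Cmod c)) in H; [|lra].
      rewrite <- Rmult_assoc, Rinv_r, Rmult_1_l in H by lra; auto.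
Qed.

Lemma point_seminorm (z : nat -> C) (l i : nat) : Omega (z i) ->
  is_seminorm (A_F Omega F) (natural_seminorm Omega z (PointIndex l i)).
Proof.
  intros Hz; split; [|split].
  - intros f _; split; [reflexivity|apply Cmod_ge_0].
  - intros f g [_ [Hf _]] [_ [Hg _]]; simpl; rewrite (C_derive_n_fplus Omega) by auto.
    apply Cmod_triangle.
  - intros c f [_ [Hf _]]; simpl; rewrite (C_derive_n_fscal Omega) by auto.
    apply Cmod_mult.
Qed.

(** * Separation of points and completeness *)

Context (I : nat -> Prop) (comp : nat -> C -> Prop) (z : nat -> C).
Hypothesis F_nonempty : exists l, F l.
Hypothesis comp_components : components_of Omega I comp.
Hypothesis z_in_comp : forall i, I i -> comp i (z i).

Lemma base_point_in_Omega (i : nat) : I i -> Omega (z i).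
Proof.
  intros Hi; destruct (proj1 comp_components i Hi) as [_ [Hsub _]]; auto.
Qed.

Lemma derivative_zero_on_components (g : C -> C) : holomorphic Omega g ->
  (forall w, Omega w -> C_derive g w = 0) -> (forall i, I i -> g (z i) = 0) ->
  forall w, Omega w -> g w = 0.
Proof.
  intros Hg Hg' Hz.
  apply (propagate_on_components Omega I comp z (fun w => g w = 0)); auto.
  intros w Hw; destruct (open_disc_subset Omega w Omega_open Hw) as [r [Hr Hsub]].
  exists r; split; [auto|split; [auto|]]; intros a b Ha Hb E.
  assert (Hmv : Cmod (g b - g a) <= 0 * Cmod (b - a)).
  { apply holomorphic_mean_value with Omega w r; auto.
    intros v Hv; rewrite Hg' by auto; rewrite Cmod_0; lra. }
  apply Cmod_eq_0; replace (g b) with (g b - g a)%C by (rewrite E; ring).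
  assert (H0 := Cmod_ge_0 (g b - g a)); lra.
Qed.

Lemma natural_seminorms_separate (f : C -> C) : A_F Omega F f ->
  (forall j, natural_index F I j -> real (natural_seminorm Omega z j f) = 0) ->
  f = (fun _ => RtoC 0).
Proof.
  intros Hf Hj; destruct (least_element F F_nonempty) as [l0 [Hl0 Hmin]].
  assert (Hfh := proj1 (proj2 Hf)).
  assert (Htop : forall w, Omega w -> C_derive_n l0 f w = 0).
  { intros w Hw; destruct (INR_unbounded (Cmod w)) as [n Hn].
    (* [S n] rather than [n], as the radii of the seminorms start at 1. *)
    assert (Hs : natural_index F I (SupIndex l0 (S n))) by (split; auto; lia).
    destruct (sup_seminorm_spec z l0 (S n) f Hf Hl0) as [_ [_ [H _]]].
    rewrite (Hj _ Hs) in H.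
    rewrite <- (proj1 (extension_spec l0 f Hf Hl0) w Hw).
    apply Cmod_eq_0, Rle_antisym; [|apply Cmod_ge_0]; apply H.
    - apply closure_subset; auto.
    - rewrite S_INR; lra. }
  (* [k] counts the steps down from the least order [l0] in [F]; at [k = l0] the statement concerns
     [f] itself. Each new order lies below [min F], so its base-point seminorms are available. *)
  assert (Hdown : forall k, (k <= l0)%nat -> forall w, Omega w -> C_derive_n (l0 - k) f w = 0).
  { induction k as [|k IH]; intros Hk; [rewrite Nat.sub_0_r; auto|].
    apply derivative_zero_on_components.
    - apply holomorphic_derive_n; auto.
    - intros w Hw; rewrite <- (IH ltac:(lia) w Hw).
      replace (l0 - k)%nat with (S (l0 - S k)) by lia; reflexivity.
    - intros i Hi; apply Cmod_eq_0, (Hj (PointIndex (l0 - S k) i)); split; auto.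
      intros m Hm; specialize (Hmin m Hm); lia. }
  apply functional_extensionality; intros w; destruct (classic (Omega w)) as [Hw|Hw].
  - specialize (Hdown l0 (Nat.le_refl l0) w Hw); rewrite Nat.sub_diag in Hdown; exact Hdown.
  - apply Hf; auto.
Qed.

Lemma natural_seminorms_complete (u : nat -> C -> C) : (forall n, A_F Omega F (u n)) ->
  (forall j, natural_index F I j -> forall eps, 0 < eps ->
     exists N, forall m n, (N <= m)%nat -> (N <= n)%nat ->
     real (natural_seminorm Omega z j (fminus (u m) (u n))) <= eps) ->
  exists f, A_F Omega F f /\ forall j, natural_index F I j -> forall eps, 0 < eps ->
    exists N, forall n, (N <= n)%nat ->
    real (natural_seminorm Omega z j (fminus (u n) f)) <= eps.
Proof.
  intros Hu Hcauchy.
  assert (Hol : forall n, holomorphic Omega (u n)) by (intros n; exact (proj1 (proj2 (Hu n)))).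
  assert (Hext : forall l, F l -> forall B eps, 0 < eps -> exists N,
    forall m n, (N <= m)%nat -> (N <= n)%nat -> forall w, closure Omega w -> Cmod w <= B ->
    Cmod (ext l (u m) w - ext l (u n) w) <= eps).
  { intros l Hl B eps Heps; destruct (INR_unbounded B) as [k Hk].
    destruct (Hcauchy (SupIndex l (S k))) with (eps := eps) as [N HN]; auto.
    { split; auto; lia. }
    exists N; intros m n Hm Hn w Hw HB; eapply Rle_trans; [|apply (HN m n Hm Hn)].
    rewrite <- extension_fminus by auto.
    destruct (sup_seminorm_spec z l (S k) (fminus (u m) (u n))) as [_ [_ [H _]]]; auto.
    { apply A_F_fminus; auto. }
    apply H; auto; rewrite S_INR; lra. }
  destruct (least_element F F_nonempty) as [l0 [Hl0 Hmin]].
  assert (Htop : loc_unif_cauchy Omega (fun n => C_derive_n l0 (u n))).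
  { intros w Hw; destruct (open_disc_subset Omega w Omega_open Hw) as [r [Hr Hsub]].
    exists r; split; [auto|split; [auto|]]; intros eps Heps.
    destruct (Hext l0 Hl0 (Cmod w + r) eps Heps) as [N HN].
    exists N; intros m n Hm Hn v Hv.
    rewrite <- (proj1 (extension_spec l0 (u m) (Hu m) Hl0) v),
      <- (proj1 (extension_spec l0 (u n) (Hu n) Hl0) v) by auto.
    apply HN; auto; [apply closure_subset; auto|apply disc_bounded; auto]. }
  assert (Hdown : forall k, (k <= l0)%nat ->
    loc_unif_cauchy Omega (fun n => C_derive_n (l0 - k) (u n))).
  { induction k as [|k IH]; intros Hk; [rewrite Nat.sub_0_r; auto|].
    assert (Hd : loc_unif_cauchy Omega (fun n => C_derive (C_derive_n (l0 - S k) (u n)))).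
    { specialize (IH ltac:(lia)); replace (l0 - k)%nat with (S (l0 - S k)) in IH by lia.
      exact IH. }
    assert (Hh : forall n, holomorphic Omega (C_derive_n (l0 - S k) (u n)))
      by (intros n; apply holomorphic_derive_n; auto).
    apply loc_unif_cauchy_integrate; auto.
    (* Convergence at one point of a small disc spreads to the others, because the derivatives
       already converge uniformly there. *)
    apply (propagate_on_components Omega I comp z
      (fun w => C_seq_cauchy (fun n => C_derive_n (l0 - S k) (u n) w))); auto.
    - intros w Hw; destruct (Hd w Hw) as [r [Hr [Hsub H]]].
      exists r; split; [auto|split; [auto|]]; intros a b Ha Hb Hc eps Heps.
      destruct (cauchy_from_derivative Omega (fun n => C_derive_n (l0 - S k) (u n)) w r
        (eps / 2)) as [N HN]; auto; [lra|].
      destruct (Hc (eps / 2)) as [N' HN']; [lra|].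
      exists (max N N'); intros m n Hm Hn.
      assert (H1 := HN m n ltac:(lia) ltac:(lia) a b Ha Hb).
      assert (H2 := HN' m n ltac:(lia) ltac:(lia)); cbv beta in H1; lra.
    - intros i Hi eps Heps.
      destruct (Hcauchy (PointIndex (l0 - S k) i)) with (eps := eps) as [N HN]; auto.
      { split; auto; intros m Hm; specialize (Hmin m Hm); lia. }
      exists N; intros m n Hm Hn; specialize (HN m n Hm Hn); simpl in HN.
      rewrite (C_derive_n_fminus Omega) in HN; auto; apply base_point_in_Omega; auto. }
  assert (Hlu : loc_unif_cauchy Omega u).
  { specialize (Hdown l0 (Nat.le_refl l0)); rewrite Nat.sub_diag in Hdown; exact Hdown. }
  (* The value 0 off [Omega] is the normalization that [A_F] requires. *)
  destruct (choice (fun w y => (Omega w -> C_seq_lim (fun n => u n w) y) /\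
    (~ Omega w -> y = 0))) as [f Hf].
  { intros w; destruct (classic (Omega w)) as [Hw|Hw].
    - destruct (C_seq_complete (fun n => u n w)) as [y Hy].
      { apply (loc_unif_cauchy_pointwise Omega u); auto. }
      exists y; tauto.
    - exists (RtoC 0); tauto. }
  assert (Hflim : forall w, Omega w -> C_seq_lim (fun n => u n w) (f w))
    by (intros w Hw; apply Hf; auto).
  assert (Hfh := loc_unif_limit_holomorphic Omega u f Omega_open Hol Hlu Hflim).
  assert (Hfd := fun l => loc_unif_limit_derive_n Omega u f l Omega_open Hol Hlu Hflim).
  assert (Hlimext : forall l, F l -> exists g,
    (forall w, closure Omega w -> C_seq_lim (fun n => ext l (u n) w) (g w)) /\
    continuous_extension Omega (C_derive_n l f) g).
  { intros l Hl.
    destruct (choice (fun w y => closure Omega w -> C_seq_lim (fun n => ext l (u n) w) y))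
      as [g Hg].
    { intros w; destruct (classic (closure Omega w)) as [Hw|Hw].
      - destruct (C_seq_complete (fun n => ext l (u n) w)) as [y Hy]; [|exists y; auto].
        intros eps Heps; destruct (Hext l Hl (Cmod w) eps Heps) as [N HN].
        exists N; intros m n Hm Hn; apply HN; auto; lra.
      - exists (RtoC 0); tauto. }
    exists g; split; [auto|split].
    (* On [Omega] the extensions are the derivatives of the [u n], which converge to the derivative
       of [f] of the same order. *)
    - intros w Hw; apply (C_seq_lim_unique (fun n => ext l (u n) w)).
      + apply Hg, closure_subset; auto.
      + replace (fun n => ext l (u n) w) with (fun n => C_derive_n l (u n) w); [auto|].
        apply functional_extensionality; intros n; symmetry.
        apply (extension_spec l (u n)); auto.
    - apply C_continuous_on; intros w Hw eps Heps.
      (* The radius [Cmod w + 1] contains every point within 1 of [w], so one [N] serves a whole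
         neighbourhood. The three thirds are the error at [v], the variation of the [N]-th
         extension, and the error at [w]. *)
      destruct (Hext l Hl (Cmod w + 1) (eps / 3)) as [N HN]; [lra|].
      destruct (proj1 (C_continuous_on _ _) (proj2 (extension_spec l (u N) (Hu N) Hl)) w Hw
        (eps / 3)) as [d [Hd H]]; [lra|].
      assert (Hclose : forall v, closure Omega v -> Cmod v <= Cmod w + 1 ->
        Cmod (g v - ext l (u N) v) <= eps / 3).
      { intros v Hv Hvb.
        apply (C_seq_lim_le (fun n => ext l (u n) v - ext l (u N) v)%C _ _ N).
        - apply C_seq_lim_minus; [apply Hg; auto|apply C_seq_lim_const].
        - intros n Hn; apply HN; auto. }
      exists (Rmin d 1); split; [apply Rmin_pos; lra|]; intros v Hv Hvw.
      assert (H1 := H v Hv (Rlt_le_trans _ _ _ Hvw (Rmin_l _ _))).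
      assert (Hvb : Cmod v <= Cmod w + 1).
      { assert (Ht := Cmod_triangle (v - w) w); replace (v - w + w)%C with v in Ht by ring.
        assert (Hm := Rlt_le_trans _ _ _ Hvw (Rmin_r _ _)); lra. }
      assert (H2 := Hclose v Hv Hvb); assert (H3 := Hclose w Hw ltac:(lra)).
      rewrite (Cmod_sym (g w)) in H3.
      assert (T1 := Cmod_minus_triangle (g v) (ext l (u N) v) (g w)).
      assert (T2 := Cmod_minus_triangle (ext l (u N) v) (ext l (u N) w) (g w)); lra. }
  assert (HfA : A_F Omega F f).
  { split; [intros w Hw; apply Hf; auto|split; [auto|]].
    intros l Hl; split; [apply holomorphic_derive_n; auto|].
    destruct (Hlimext l Hl) as [g [_ Hg]]; exists g; auto. }
  exists f; split; auto; intros [l n|l i] Hj eps Heps.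
  - destruct Hj as [Hl Hn].
    destruct (Hext l Hl (INR n) eps Heps) as [N HN]; exists N; intros m Hm.
    destruct (Hlimext l Hl) as [g [Hg Hg']].
    apply (sup_seminorm_spec z l n (fminus (u m) f)); auto; [apply A_F_fminus; auto|lra|].
    intros w Hw Hwn; rewrite extension_fminus by auto.
    rewrite (extension_unique l f g w) by auto.
    (* [k] tends to infinity in the Cauchy bound while [m] stays fixed; [N] does not depend on [w],
       so the bound passes to the supremum. *)
    apply (C_seq_lim_le (fun k => ext l (u m) w - ext l (u k) w)%C _ _ N).
    + apply C_seq_lim_minus; [apply C_seq_lim_const|apply Hg; auto].
    + intros k Hk; apply HN; auto.
  - destruct Hj as [Hl Hi].
    destruct (Hfd l (z i) (base_point_in_Omega i Hi) eps Heps) as [N HN].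
    exists N; intros n Hn; simpl; rewrite (C_derive_n_fminus Omega); auto.
    apply base_point_in_Omega; auto.
Qed.

End HolomorphicSpace.

Theorem theorem3p6 (Omega : C -> Prop) (F : nat -> Prop) (I : nat -> Prop)
    (comp : nat -> C -> Prop) (z : nat -> C) (e : nat -> seminorm_index)
    (Omega_open : open Omega)
    (F_nonempty : exists l, F l)
    (I_index : finite_or_full I)
    (comp_components : components_of Omega I comp)
    (z_in_comp : forall i, I i -> comp i (z i))
    (e_enumerates : enumerates e (natural_index F I)) :
  frechet_space (A_F Omega F) (natural_index F I) (natural_seminorm Omega z)
    (seminorm_dist (natural_seminorm Omega z) e).
Proof.
  apply frechet_of_seminorms; auto.
  - apply A_F_linear; auto.
  - intros [l n|l i] Hj.
    + apply sup_seminorm; [auto|apply Hj].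
    + apply point_seminorm; auto.
      apply (base_point_in_Omega Omega I comp); auto; apply Hj.
  - intros f Hf H; apply (natural_seminorms_separate Omega F Omega_open I comp z); auto.
  - intros u Hu H; apply (natural_seminorms_complete Omega F Omega_open I comp z); auto.
Qed.
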